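(* Let $n\ge 1$. Every regular subalgebra of the complex special linear Lie algebra $\mathfrak{sl}_{n+1}$ is either narrow or wide.
   Context: All Lie algebras and modules are finite-dimensional over $\mathbb{C}$. A regular subalgebra of a semisimple Lie algebra $\mathfrak{g}$ is a subalgebra normalized by some Cartan subalgebra of $\mathfrak{g}$. Fixing a Cartan subalgebra $\mathfrak{h}$ with root system $\Phi$, every regular subalgebra is conjugate under the adjoint group to one normalized by $\mathfrak{h}$, and (by convention) regular subalgebras are taken in this form: $\mathfrak{s}_{T,\mathfrak{t}}=\mathfrak{t}\oplus\bigoplus_{\alpha\in T}\mathfrak{g}_\alpha$, where $T\subseteq\Phi$ is closed (i.e. $x,y\in T$, $x+y\in\Phi$ imply $x+y\in T$) and $\mathfrak{t}\subseteq\mathfrak{h}$ is a subspace containing $[\mathfrak{g}_\alpha,\mathfrak{g}_{-\alpha}]$ for every $\alpha\in T$ with $-\alpha\in T$. A subalgebra $\mathfrak{s}\subseteq\mathfrak{g}$ is wide if every simple $\mathfrak{g}$-module is indecomposable as an $\mathfrak{s}$-module. It is narrow if every non-trivial simple $\mathfrak{g}$-module (i.e. every $V(\lambda)$ with highest weight $\lambda\neq 0$), restricted to $\mathfrak{s}$, has a proper decomposition, i.e. is a direct sum of two nonzero $\mathfrak{s}$-submodules. *)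

(* Defs.v *)
From HB Require Import structures.
From mathcomp Require Import all_boot all_order all_algebra.
From mathcomp Require Import ring.
From mathcomp Require Export reals complex.

Set Implicit Arguments.
Unset Strict Implicit.
Unset Printing Implicit Defensive.

Import GRing.Theory.
Local Open Scope ring_scope.

HB.mixin Record Vector_isLie (F : fieldType) L of Vector F L := {
  lie : L -> L -> L;
  lie_linearl : forall (y : L) (a : F) (x1 x2 : L),
    lie (a *: x1 + x2) y = a *: lie x1 y + lie x2 y;
  lie_linearr : forall (x : L) (a : F) (y1 y2 : L),
    lie x (a *: y1 + y2) = a *: lie x y1 + lie x y2;
  liexx : forall x : L, lie x x = 0;
  lie_jacobi : forall x y z : L,
    lie x (lie y z) + lie y (lie z x) + lie z (lie x y) = 0
}.

#[short(type="lieAlgType")]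
HB.structure Definition LieAlgebra (F : fieldType) :=
  {L of Vector F L & Vector_isLie F L}.

Section Subalgebras.

Variables (F : fieldType) (L : lieAlgType F).
Implicit Types (x y : L) (H S U V : {vspace L}).

Definition lie_subalgebra S : Prop := {in S &, forall x y, lie x y \in S}.

(* [U, V]: brackets of basis vectors suffice, by bilinearity. *)
Definition liev U V : {vspace L} :=
  <<allpairs lie (vbasis U) (vbasis V)>>%VS.

Definition lower_central H k : {vspace L} := iter k (liev H) H.

Definition lie_nilpotent H : Prop := exists k, lower_central H k = 0%VS.

Definition normalizes H S : Prop := {in H & S, forall x y, lie x y \in S}.

(* Nilpotent and self-normalizing; for semisimple L over the complex
   numbers these are also the maximal toral subalgebras. *)
Definition cartan H : Prop :=
  [/\ lie_subalgebra H, lie_nilpotent H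
    & forall x, {in H, forall y, lie x y \in H} -> x \in H].

Definition regular S : Prop :=
  lie_subalgebra S /\ exists2 H, cartan H & normalizes H S.

End Subalgebras.

Section Modules.

Variables (F : fieldType) (L : lieAlgType F).

Definition lie_rep (V : vectType F) (rho : {linear L -> 'End(V)}) : Prop :=
  forall x y : L,
    rho (lie x y) = (rho x \o rho y)%VF - (rho y \o rho x)%VF.

Section OneModule.

Variables (V : vectType F) (rho : {linear L -> 'End(V)}).
Implicit Types (S : {vspace L}) (W : {vspace V}).

Definition submodule S W : Prop :=
  {in S & W, forall x v, rho x v \in W}.

Definition simple_module : Prop :=
  (fullv != 0 :> {vspace V})%VS /\
  forall W, submodule fullv W -> W = 0%VS \/ W = fullv.

(* A simple module is trivial exactly when L acts by zero: it is then the
   one-dimensional module of highest weight 0. *)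
Definition nontrivial_module : Prop := exists x (v : V), rho x v != 0.

Definition decomposable S : Prop :=
  exists W1 W2 : {vspace V},
    [/\ submodule S W1 /\ submodule S W2, W1 != 0%VS, W2 != 0%VS,
        (W1 + W2)%VS = fullv & (W1 :&: W2)%VS = 0%VS].

Definition indecomposable S : Prop :=
  (fullv != 0 :> {vspace V})%VS /\ ~ decomposable S.

End OneModule.

Definition wide (S : {vspace L}) : Prop :=
  forall (V : vectType F) (rho : {linear L -> 'End(V)}),
    lie_rep rho -> simple_module rho -> indecomposable rho S.

Definition narrow (S : {vspace L}) : Prop :=
  forall (V : vectType F) (rho : {linear L -> 'End(V)}),
    lie_rep rho -> simple_module rho -> nontrivial_module rho ->
    decomposable rho S.

End Modules.

Section SpecialLinear.

Variables (F : fieldType) (m : nat).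

Definition slv : {vspace 'M[F]_m} :=
  lker (linfun (mxtrace : 'M[F]_m -> F^o)).

Lemma mem_slv (A : 'M[F]_m) : (A \in slv) = (\tr A == 0).
Proof. by rewrite memv_ker lfunE. Qed.

Definition sl : Type := subvs_of slv.

HB.instance Definition _ := Vector.on sl.

Fact sl_lie_subproof (A B : sl) :
  vsval A *m vsval B - vsval B *m vsval A \in slv.
Proof. by rewrite mem_slv linearB /= mxtrace_mulC subrr. Qed.

Definition sl_lie (A B : sl) : sl := Subvs (sl_lie_subproof A B).

Fact sl_lie_linearl (B : sl) (a : F) (A1 A2 : sl) :
  sl_lie (a *: A1 + A2) B = a *: sl_lie A1 B + sl_lie A2 B.
Proof.
apply/val_inj; rewrite /= mulmxDl mulmxDr -scalemxAl -scalemxAr.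
by rewrite opprD addrACA scalerBr.
Qed.

Fact sl_lie_linearr (A : sl) (a : F) (B1 B2 : sl) :
  sl_lie A (a *: B1 + B2) = a *: sl_lie A B1 + sl_lie A B2.
Proof.
apply/val_inj; rewrite /= mulmxDl mulmxDr -scalemxAl -scalemxAr.
by rewrite opprD addrACA scalerBr.
Qed.

Fact sl_liexx (A : sl) : sl_lie A A = 0.
Proof. by apply/val_inj; rewrite /= subrr. Qed.

Fact sl_lie_jacobi (A B C : sl) :
  sl_lie A (sl_lie B C) + sl_lie B (sl_lie C A) + sl_lie C (sl_lie A B) = 0.
Proof.
case: A B C => [A hA] [B hB] [C hC].
apply/val_inj; rewrite /= !mulmxBl !mulmxBr !mulmxA.
move: (A *m B *m C) (A *m C *m B) (B *m A *m C).
move: (B *m C *m A) (C *m A *m B) (C *m B *m A) => M1 M2 M3 M4 M5 M6.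
by apply/matrixP=> i j; rewrite !mxE; ring.
Qed.

HB.instance Definition _ := Vector_isLie.Build F sl
  sl_lie_linearl sl_lie_linearr sl_liexx sl_lie_jacobi.

End SpecialLinear.

(* Main.v *)
Require Import Defs.
From HB Require Import structures.
From mathcomp Require Import all_boot all_order all_algebra.
From mathcomp Require Import ring zify boolp.

(**
Fix a Cartan subalgebra H normalizing s.  In a suitable basis of F^(n+1), with
matrix units E_ij, H contains every traceless diagonal matrix, so s is stable
under the diagonal torus and splits into a diagonal part and root lines
F E_ij.  Let G be the graph on the indices 0..n with an edge between i and j
whenever E_ij or E_ji lies in s.  Then s is wide if G is connected and narrow
if it is not.

The basis [cartan_contains_torus].  A matrix centralizing H is, up to a scalar,
an element of H, because H is self-normalizing; hence such matrices commute
with one another.  Write 1 as a sum of primitive idempotents centralizing H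
and diagonalize them simultaneously.  A primitive idempotent p splits no
further, so each h in H has a single eigenvalue on the image of p (a spectral
projection of h centralizes H, since H is nilpotent); thus ad h is nilpotent
on the traceless part of p gl p, and an Engel argument, [cartan_absorbs], puts
this part inside H.  If p had rank at least 2, H would contain a copy of sl_2
and could not be nilpotent.  So the p are the E_jj.

Disconnected graph [separated_has_idempotent].  Let z be the traceless part of
the projection on a union P of components.  It commutes with s, so the spectral
projections of its action on a module V commute with s.  If the action of z on
V had only one eigenvalue c, then ad z would be nilpotent on End V; but z scales
every E_ij joining P to its complement by 1 or -1, so those E_ij would act by
zero, and they generate sl_(n+1).  Hence a nontrivial V decomposes.

Connected graph [connected_idempotent].  Let V be simple and let A be the
algebra of endomorphisms of V commuting with s.  The torus acts on A, which is
therefore graded by weights.  An element of A of weight 0 commutes with the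
torus and with one root vector of each edge; by sl_2 theory
[sl2_commutant] it commutes with the opposite root vector as well, hence, the
graph being connected, with sl_(n+1), and it is a scalar.  When the degree 0
part of a graded matrix algebra consists of scalars, the normalized trace is
multiplicative on it, so an idempotent has normalized trace 0 or 1 and is 0 or
1 [graded_idempotent].  So V is indecomposable over s.

Everything is done over a field of characteristic 0 in which all polynomials
split.
*)

Set Implicit Arguments.
Unset Strict Implicit.
Unset Printing Implicit Defensive.

Import GRing.Theory Num.Theory.
Local Open Scope ring_scope.

(** * Commutators of matrices *)

Section Bracket.

Variables (F : fieldType) (m : nat).
Implicit Types (A B C X : 'M[F]_m) (c : F).

Definition br A B := A * B - B * A.

Fact br_is_linear A : linear (br A).
Proof.
move=> c X Y; rewrite /br -!mulmxE mulmxDr mulmxDl -scalemxAr -scalemxAl scalerBr.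
by rewrite opprD addrACA.
Qed.
HB.instance Definition _ A :=
  GRing.isLinear.Build F 'M[F]_m 'M[F]_m *:%R (br A) (br_is_linear A).

Lemma brC A B : br B A = - br A B.
Proof. by rewrite /br opprB. Qed.

(** The Jacobi identity in the form: ad A is a derivation of the bracket. *)
Lemma br_jacobi A B C : br A (br B C) = br (br A B) C + br B (br A C).
Proof.
rewrite /br !mulrBr !mulrBl !mulrA.
move: (A * B * C) (A * C * B) (B * C * A) (C * B * A) (B * A * C) (C * A * B).
move=> a b c d e f; rewrite !opprB.
rewrite -[_ - _ + _ + _]addrA [in RHS]addrC -!addrA.
by apply/matrixP=> i j; rewrite !mxE; ring.
Qed.

Lemma br_scalar c A : br c%:M A = 0.
Proof. by rewrite /br -!mulmxE scalar_mxC subrr. Qed.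

Lemma br_eq0 A B : br A B = 0 <-> A * B = B * A.
Proof. by split=> [/subr0_eq // | eAB]; rewrite /br eAB subrr. Qed.

Lemma mxtrace_br A B : \tr (br A B) = 0.
Proof. by rewrite /br linearB /= mxtrace_mulC subrr. Qed.

Lemma brDl A B X : br (A + B) X = br A X + br B X.
Proof. by rewrite /br mulrDl mulrDr opprD addrACA. Qed.

Lemma brZl c A X : br (c *: A) X = c *: br A X.
Proof. by rewrite /br -!mulmxE -scalemxAr -scalemxAl scalerBr. Qed.

Lemma brNl A X : br (- A) X = - br A X.
Proof. by rewrite /br mulNr mulrN !opprB opprK addrC. Qed.

Lemma iter_linear (f : {linear 'M[F]_m -> 'M[F]_m}) k : linear (iter k f).
Proof.
elim: k => [|k IHk] c X Y //=.
by rewrite IHk linearP.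
Qed.

Lemma br_scalarB c A X : br (A - c%:M) X = br A X.
Proof. by rewrite brDl brNl br_scalar subr0. Qed.

(** Left and right multiplication by A commute and are both nilpotent of order k
on the corner of p, so their difference is nilpotent of order 2k.  The
induction runs over all monomials A^a X A^b at once, which avoids the binomial
formula. *)
Lemma iter_br_eq0 A p X k :
    A ^+ k * p = 0 -> p * A ^+ k = 0 -> p * X * p = X ->
  iter (k + k) (br A) X = 0.
Proof.
move=> Akp pAk pXp.
suff gen t a b : (k + k <= t + (a + b))%N ->
    iter t (br A) (A ^+ a * X * A ^+ b) = 0.
  by have := gen (k + k)%N 0%N 0%N; rewrite expr0 mul1r mulr1 !addn0; apply.
elim: t a b => [|t IHt] a b le_k.
  rewrite /= -pXp; have [le_a|lt_a] := leqP k a.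
    by rewrite -(subnK le_a) exprD !mulrA -(mulrA _ (A ^+ k) p) Akp mulr0 !mul0r.
  have le_b : (k <= b)%N by lia.
  by rewrite -(subnKC le_b) exprD !mulrA -(mulrA _ p (A ^+ k)) pAk mulr0 mul0r.
rewrite iterSr {2}/br !mulrA -exprS -[_ * A]mulrA -exprSr.
by rewrite addrC -scaleN1r iter_linear !IHt ?scaler0 ?addr0 //; lia.
Qed.

End Bracket.

(** * Idempotents and spectral projections *)

Definition splits_polys (F : fieldType) : Prop :=
  forall p : {poly F}, exists l : seq F, p = lead_coef p *: \prod_(c <- l) ('X - c%:P).

Section Idempotents.

Variable (F : fieldType).

(** The projection on a generalized eigenspace along the others is a polynomial
in A, obtained from a Bezout relation between a power of X - c and the cofactor
of the characteristic polynomial.  The exponent is one more than the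
multiplicity of c, so that it is positive whether or not c is an eigenvalue. *)
Lemma spectral_idempotent (m : nat) (A : 'M[F]_m.+1) (c : F) :
  exists q : {poly F}, let e := horner_mx A q in
    [/\ e * e = e, exists k, (A - c%:M) ^+ k * e = 0
      & forall v : 'rV_m.+1, v *m A = c *: v -> v *m e = v].
Proof.
have chi_neq0 : char_poly A != 0 by apply/monic_neq0/char_poly_monic.
have [k [r rc chiE]] := multiplicity_XsubC (char_poly A) c.
rewrite chi_neq0 /= in rc.
pose d := ('X - c%:P) ^+ k.+1.
have dE : horner_mx A d = (A - c%:M) ^+ k.+1.
  by rewrite rmorphXn rmorphB /= horner_mx_X horner_mx_C.
have chiA : horner_mx A (d * r) = 0.
  by rewrite /d exprS -mulrA [_ * r]mulrC -chiE rmorphM /= Cayley_Hamilton mulr0.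
have : coprimep d r by rewrite coprimep_expl // coprimep_sym coprimep_XsubC.
case/Bezout_eq1_coprimepP=> -[u v] /= uv1.
exists (v * r); split=> [||w wA].
- apply/eqP; rewrite -rmorphM -subr_eq0 -rmorphB /=.
  have -> : v * r * (v * r) - v * r = - (d * r) * (u * v).
    have -> : v * r = 1 - u * d by rewrite -uv1 addrAC subrr add0r.
    have ur : r * v = 1 - u * d by rewrite -uv1 addrAC subrr add0r mulrC.
    by rewrite mulNr mulrACA [d * u]mulrC ur; ring.
  by rewrite rmorphM rmorphN /= chiA oppr0 mul0r.
- exists k.+1; rewrite -dE -rmorphM /= mulrCA rmorphM /= chiA mulr0 //.
- have -> : v * r = 1 - d * u by rewrite -uv1 mulrC; ring.
  rewrite rmorphB rmorph1 rmorphM /= dE exprS mulmxBr mulmx1 -!mulmxE !mulmxA.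
  by rewrite mulmxBr wA mul_mx_scalar subrr !mul0mx subr0.
Qed.

Lemma eigenvector_of_prod (m : nat) (A : 'M[F]_m.+1) (l : seq F) (v : 'rV_m.+1) :
    v != 0 -> v *m horner_mx A (\prod_(c <- l) ('X - c%:P)) = 0 ->
  exists (c : F) (q : {poly F}), let w := v *m horner_mx A q in w != 0 /\ w *m A = c *: w.
Proof.
move=> v0; elim: l => [|c l IHl].
  by rewrite big_nil rmorph1 mulmx1 => v1; rewrite v1 eqxx in v0.
set q := \prod_(c <- l) _ in IHl *.
rewrite big_cons mulrC rmorphM /= -mulmxE mulmxA => vq0.
have [/IHl //|vq_neq0] := eqVneq (v *m horner_mx A q) 0.
exists c, q; split=> //; apply/eqP.
rewrite -subr_eq0 -mul_mx_scalar -mulmxBr -[X in _ == X]vq0.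
by rewrite rmorphB /= horner_mx_X horner_mx_C.
Qed.

(** The eigenvector is found among the polynomial images of a given vector, so it
stays in any subspace stable under A. *)
Lemma eigenvector_in_orbit (m : nat) (A : 'M[F]_m.+1) (v : 'rV_m.+1) :
    splits_polys F -> v != 0 ->
  exists (c : F) (q : {poly F}), let w := v *m horner_mx A q in w != 0 /\ w *m A = c *: w.
Proof.
move=> splitF v0; have [l chiE] := splitF (char_poly A).
apply: (@eigenvector_of_prod _ _ l) => //.
move: chiE; rewrite (monicP (char_poly_monic A)) scale1r => <-.
by rewrite Cayley_Hamilton mulmx0.
Qed.

Lemma exists_eigenvector (m : nat) (A : 'M[F]_m.+1) : splits_polys F ->
  exists (c : F) (v : 'rV_m.+1), v != 0 /\ v *m A = c *: v.
Proof.
move=> splitF; have v0 : const_mx 1 != 0 :> 'rV[F]_m.+1.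
  by apply/eqP => /matrixP/(_ 0 0) /eqP; rewrite !mxE oner_eq0.
have [c [q [w0 wA]]] := eigenvector_in_orbit A splitF v0.
by exists c, (const_mx 1 *m horner_mx A q).
Qed.

End Idempotents.

Section Corners.

Variables (F : fieldType) (m : nat).
Implicit Types (A X e f p : 'M[F]_m).


(** An element Y of e gl f with [A, Y] = 0 commutes with e, so Y = e Y f = Y e f = 0:
ad A is injective on this corner, hence so are its powers. *)
Lemma bicommutant_corner_eq0 A e f X k :
    e * e = e -> e * f = 0 ->
    (forall Y, A * Y = Y * A -> e * Y = Y * e) ->
    (forall Y, A * Y = Y * A -> f * Y = Y * f) ->
  iter k (br A) X = 0 -> e * X * f = 0.
Proof.
move=> ee ef0 eA fA.
have eAC : e * A = A * e by apply: eA.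
have fAC : f * A = A * f by apply: fA.
have ebr Y : e * br A Y * f = br A (e * Y * f).
  rewrite /br mulrBr mulrBl !mulrA eAC -!mulrA; congr (_ - e * (Y * _)).
  by rewrite fAC.
have eiter j Y : e * iter j (br A) Y * f = iter j (br A) (e * Y * f).
  by elim: j => //= j <-; rewrite ebr.
move=> Xk0; have : iter k (br A) (e * X * f) = 0 by rewrite -eiter Xk0 mulr0 mul0r.
elim: k X {Xk0} => [|k IHk] X //; rewrite iterSr -ebr.
move=> /IHk; rewrite ebr => /br_eq0 /eA.
by rewrite !mulrA ee -!mulrA -(eA f) // !mulrA => ->; rewrite -!mulrA ef0 !mulr0.
Qed.

(** Both off-diagonal corners of X with respect to e vanish.  This is what makes a
spectral projection of h commute with all elements on which ad h is
nilpotent. *)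
Lemma idempotent_commutes A e X k :
    e * e = e -> (forall Y, A * Y = Y * A -> e * Y = Y * e) ->
  iter k (br A) X = 0 -> e * X = X * e.
Proof.
move=> ee eA Xk0; pose f := 1 - e.
have ff : f * f = f by rewrite /f mulrBr mulr1 mulrBl mul1r ee subrr subr0.
have ef : e * f = 0 by rewrite /f mulrBr mulr1 ee subrr.
have fe : f * e = 0 by rewrite /f mulrBl mul1r ee subrr.
have fA Y : A * Y = Y * A -> f * Y = Y * f.
  by move=> /eA eY; rewrite /f mulrBl mulrBr mul1r mulr1 eY.
have eXf := bicommutant_corner_eq0 ee ef eA fA Xk0.
have fXe := bicommutant_corner_eq0 ff fe fA eA Xk0.
rewrite /f mulrBr mulr1 in eXf; rewrite /f -mulrA mulrBl mul1r mulrA in fXe.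
by rewrite (subr0_eq eXf) (subr0_eq fXe).
Qed.

Lemma mxrank_subidem e p :
  e * e = e -> e * p = e -> p * e = e -> e != p -> (\rank e < \rank p)%N.
Proof.
move=> ee ep pe; apply: contraR; rewrite -leqNgt => le_pe.
have sep : (e <= p)%MS by rewrite -ep -mulmxE submxMl.
have /andP[_] : (e == p)%MS.
  by rewrite -(mxrank_leqif_eq sep) eqn_leq le_pe mxrankS.
by case/submxP=> u pE; move: pe; rewrite pE !mulmxE -mulrA ee => ->.
Qed.

Lemma mxtrace_idem e : e * e = e -> \tr e = (\rank e)%:R.
Proof.
move=> ee; rewrite -{1}(mulmx_base e) mxtrace_mulC.
suff -> : row_base e *m col_base e = 1%:M by rewrite mxtrace1.
apply: (row_free_inj (row_base_free e)); rewrite mul1mx.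
apply: (@row_full_inj _ _ _ _ (col_base e)); first exact: col_base_full.
by rewrite -mulmxA (mulmx_base e) mulmxA mulmx_base mulmxE ee.
Qed.

End Corners.

(** * An Engel argument for Cartan subalgebras *)

Section CartanAbsorption.

Variables (F : fieldType) (L : lieAlgType F).
Implicit Types (x y a b : L) (H S U V : {vspace L}).

Fact lie_right_is_linear x : linear (lie x).
Proof. by move=> c y z; rewrite lie_linearr. Qed.
HB.instance Definition _ x :=
  GRing.isLinear.Build F L L *:%R (lie x) (lie_right_is_linear x).

Lemma lieDl x y z : lie (x + y) z = lie x z + lie y z.
Proof. by have := lie_linearl z 1 x y; rewrite !scale1r. Qed.

Lemma lieZl c x z : lie (c *: x) z = c *: lie x z.
Proof.
have lie0 : lie (0 : L) z = 0.
  by apply: (addIr (lie 0 z)); rewrite -lieDl !add0r.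
by have := lie_linearl z c x 0; rewrite !addr0 lie0 addr0.
Qed.

Lemma lieC x y : lie y x = - lie x y.
Proof.
apply/eqP; rewrite -addr_eq0 addrC; apply/eqP.
by have := liexx (x + y); rewrite lieDl !linearD /= !liexx add0r addr0.
Qed.

Lemma lie_derivation a b x : lie a (lie b x) = lie (lie a b) x + lie b (lie a x).
Proof.
have := lie_jacobi a b x; rewrite (lieC a x) linearN /= (lieC _ x) => jac.
by apply/eqP; rewrite -subr_eq0 opprD addrA [_ - _ - _]addrAC jac.
Qed.

Lemma memv_liev U V x y : x \in U -> y \in V -> lie x y \in liev U V.
Proof.
move=> /coord_vbasis -> /coord_vbasis ->; rewrite linear_sum memv_suml // => j _.
rewrite linearZ memvZ //=.
elim/big_rec: _ => [|i z _ IHz].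
  by have := lieZl 0 0 (vbasis V)`_j; rewrite !scale0r => ->; rewrite mem0v.
rewrite lieDl lieZl memvD // memvZ // memv_span //.
by apply: allpairs_f; rewrite mem_nth // size_tuple.
Qed.

Lemma lower_central_sub H k : lie_subalgebra H -> (lower_central H k <= H)%VS.
Proof.
move=> Hsub; elim: k => [|k IHk]; first exact: subvv.
apply/span_subvP => _ /allpairsP[[x y] [/= /vbasis_mem xH /vbasis_mem yU ->]].
by apply: Hsub => //; apply: (subvP IHk).
Qed.

Lemma iter_lie_lower_central H a x k :
  a \in H -> x \in H -> iter k (lie a) x \in lower_central H k.
Proof.
by move=> aH xH; elim: k => //= k IHk; apply: memv_liev.
Qed.

(** Suppose x0 in X lies outside H.  By induction on d there are an ideal S of H of
dimension at least d and an element x of X outside H with [S, x] inside H.  To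
enlarge S, nilpotency of H provides a in H outside S with [H, a] inside S, and
the last iterate of ad a on x that is not in H serves as the new x.  For S = H
the element x normalizes H, hence belongs to it. *)
Theorem cartan_absorbs H (X : L -> Prop) :
    cartan H -> (forall a x, a \in H -> X x -> X (lie a x)) ->
    (forall a x, a \in H -> X x -> exists k, iter k (lie a) x \in H) ->
  forall x, X x -> x \in H.
Proof.
case=> Hsub [K HK0] Hnorm Xstable Xnil x0 Xx0; apply/idPn => x0H.
suff /(_ _ (leqnn _)) [S [sSH dimS _ [x [Xx xH Sx]]]] d : (d <= \dim H)%N ->
    exists S, [/\ (S <= H)%VS, (d <= \dim S)%N,
      forall h a, h \in H -> a \in S -> lie h a \in S
      & exists x, [/\ X x, x \notin H & forall a, a \in S -> lie a x \in H]].
  have {dimS sSH} SH : S = H by apply/eqP; rewrite eqEdim sSH.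
  case/negP: xH; apply: Hnorm => y yH.
  by rewrite lieC rpredN Sx // SH.
elim: d => [_|d IHd lt_d].
  exists 0%VS; split=> // [|h a _|]; rewrite ?sub0v //.
    by rewrite memv0 => /eqP ->; rewrite linear0 mem0v.
  exists x0; split=> // a; rewrite memv0 => /eqP ->.
  by have := lieZl 0 0 x0; rewrite !scale0r => ->; rewrite mem0v.
have [S [sSH dimS Sideal [x [Xx xH Sx]]]] := IHd (ltnW lt_d).
have [lt_dS|] := ltnP d (\dim S).
  by exists S; split=> //; exists x.
move=> le_Sd; have {le_Sd} dS : \dim S = d by apply/eqP; rewrite eqn_leq le_Sd.
have ltSH : ~~ (H <= S)%VS.
  by apply: contraL lt_d => /dimvS; rewrite dS -leqNgt.
have ex_lc : exists k, (lower_central H k <= S)%VS.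
  by exists K; rewrite HK0 sub0v.
(* The last term of the central series not contained in S provides a. *)
have [[|j] lcS min_j] := ex_minnP ex_lc; first by case/negP: ltSH.
have /subvPn [a a_lc aS] : ~~ (lower_central H j <= S)%VS.
  by apply/negP => /min_j; rewrite ltnn.
have aH : a \in H by apply: (subvP (lower_central_sub j Hsub)).
have Ha h : h \in H -> lie h a \in S.
  by move=> hH; apply: (subvP lcS); apply: memv_liev.
(* The iterate of order k.+1 is the first one in H, so that of order k is the new x. *)
have [k ak_min k_min] := ex_minnP (Xnil a x aH Xx).
case: k => [|k] in ak_min k_min *; first by rewrite ak_min in xH.
have Xi i : X (iter i (lie a) x) by elim: i => //= i; apply: Xstable.
have Si i b : b \in S -> lie b (iter i (lie a) x) \in H.
  elim: i b => [|i IHi] b bS /=; first exact: Sx.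
  rewrite lie_derivation rpredD //; last by apply: Hsub => //; apply: IHi.
  by apply: IHi; apply: Ha; apply: (subvP sSH).
exists (S + <[a]>)%VS; split=> [|||].
- by rewrite subv_add sSH -memvE.
- rewrite -dS -(addn1 (\dim S)) dimv_disjoint_sum ?leq_add2l.
    by rewrite dim_vline lt0b; apply: contraNneq aS => ->; apply: mem0v.
  apply/eqP; rewrite -subv0; apply/subvP=> y; rewrite memv_cap => /andP[yS].
  case/vlineP=> c yE; rewrite memv0; apply: contraNT aS => y0.
  have c0 : c != 0 by apply: contraNneq y0 => c0; rewrite yE c0 scale0r.
  by rewrite -(scalerK c0 a) -yE memvZ.
- move=> h _ hH /memv_addP[b bS [_ /vlineP[c ->] ->]].
  rewrite linearD linearZ /= (subvP (addvSl _ _)) // rpredD ?memvZ ?Ha //.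
  exact: Sideal.
exists (iter k (lie a) x); split=> //.
  by apply/negP => /k_min; rewrite ltnn.
move=> _ /memv_addP[b bS [_ /vlineP[c ->] ->]].
by rewrite lieDl lieZl rpredD ?Si // memvZ.
Qed.

End CartanAbsorption.

(** * Primitive idempotents, conjugation and matrix units *)

Section PrimitiveIdempotents.

Variables (F : fieldType) (m : nat) (C : 'M[F]_m -> Prop).
Hypothesis C_sub : forall A B, C A -> C B -> C (A - B).
Hypothesis C_mul : forall A B, C A -> C B -> C (A * B).
Implicit Types e p : 'M[F]_m.

Definition primitive p : Prop :=
  [/\ p * p = p, C p, p != 0
    & forall e, C e -> e * e = e -> e * p = e -> p * e = e -> e = 0 \/ e = p].

(** Splitting an idempotent into two nonzero orthogonal ones lowers the rank. *)
Lemma primitive_decomposition p : C p -> p * p = p ->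
  exists2 ps : seq 'M[F]_m, (forall q, q \in ps -> primitive q)
    & \sum_(q <- ps) q = p.
Proof.
have [d] := ubnP (\rank p); elim: d p => // d IHd p lt_pd Cp pp.
have [->|p0] := eqVneq p 0; first by exists [::]; rewrite ?big_nil.
have [pP|] := pselect (primitive p).
  by exists [:: p]; rewrite ?big_seq1 // => q; rewrite inE => /eqP ->.
move=> npP; have [e [Ce ee [ep pe e0 e_p]]] : exists e,
    [/\ C e, e * e = e & [/\ e * p = e, p * e = e, e != 0 & e != p]].
  apply: contrapT => noe; apply: npP; split=> // e Ce ee ep pe.
  have [->|e0] := eqVneq e 0; first by left.
  have [->|e_p] := eqVneq e p; first by right.
  by case: noe; exists e.
have qq : (p - e) * (p - e) = p - e.
  by rewrite mulrBr !mulrBl pp pe ep ee subrr subr0.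
have lt_e : (\rank e < d)%N.
  by apply: leq_trans (_ : \rank p <= d)%N; rewrite ?mxrank_subidem.
have lt_q : (\rank (p - e)%R < d)%N.
  apply: leq_trans (_ : \rank p <= d)%N => //; apply: mxrank_subidem => //.
  - by rewrite mulrBl pp ep.
  - by rewrite mulrBr pp pe.
  - by rewrite -subr_eq0 addrAC subrr add0r oppr_eq0.
have [ps psP ps_e] := IHd e lt_e Ce ee.
have [ps' ps'P ps'_e] := IHd (p - e) lt_q (C_sub Cp Ce) qq.
exists (ps ++ ps'); last by rewrite big_cat /= ps_e ps'_e addrC subrK.
by move=> q; rewrite mem_cat => /orP[/psP|/ps'P].
Qed.

End PrimitiveIdempotents.

Lemma idem_diagonalizable (F : fieldType) (m : nat) (p : 'M[F]_m.+1) :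
  p * p = p -> diagonalizable p.
Proof.
move=> pp; apply/diagonalizableP; exists [:: 0; 1].
  by rewrite /= inE eq_sym oner_eq0.
apply: mxminpoly_min; rewrite !big_cons big_nil mulr1 subr0 rmorphM rmorphB /=.
by rewrite horner_mx_X horner_mx_C mulrBr mulr1 pp subrr.
Qed.

Section Conjugation.

Variables (F : fieldType) (m : nat) (P : 'M[F]_m).
Hypothesis Punit : P \in unitmx.
Implicit Types A B : 'M[F]_m.

Definition conj_by A : 'M[F]_m := invmx P * A * P.

Lemma conj_byM A B : conj_by A * conj_by B = conj_by (A * B).
Proof.
rewrite /conj_by -!mulrA; congr (_ * (_ * _)).
by rewrite -!mulmxE mulKVmx.
Qed.

Fact conj_by_is_linear : linear conj_by.
Proof.
move=> c A B; rewrite /conj_by -!mulmxE mulmxDr mulmxDl.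
by rewrite -scalemxAr -scalemxAl.
Qed.
HB.instance Definition _ :=
  GRing.isLinear.Build F 'M[F]_m 'M[F]_m *:%R conj_by conj_by_is_linear.

Lemma conj_by_br A B : conj_by (br A B) = br (conj_by A) (conj_by B).
Proof. by rewrite /br linearB /= !conj_byM. Qed.

Lemma mxtrace_conj_by A : \tr (conj_by A) = \tr A.
Proof. by rewrite mxtrace_mulC -mulmxE mulKVmx. Qed.

Lemma conj_by_inj : injective conj_by.
Proof.
move=> A B /(congr1 (fun C => P *m C *m invmx P)).
by rewrite /conj_by -!mulmxE !mulmxA mulmxV // !mul1mx !mulmxK.
Qed.

Lemma conj_by_inv A : conj_by (P *m A *m invmx P) = A.
Proof. by rewrite /conj_by -!mulmxE !mulmxA mulVmx // mul1mx mulmxKV. Qed.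

End Conjugation.

Section MatrixUnits.

Variables (F : fieldType) (m : nat).
Notation E i j := (delta_mx i j : 'M[F]_m).

Lemma mul_delta (i j k l : 'I_m) : E i j * E k l = E i l *+ (j == k).
Proof. by rewrite -mulmxE mul_delta_mx_cond. Qed.

Lemma mul_diag_delta_diag (D : 'M[F]_m) (j k : 'I_m) :
  is_diag_mx D -> D * E j k * D = (D j j * D k k) *: E j k.
Proof.
move=> /diag_mxP[d ->]; rewrite -!mulmxE mul_diag_mx mul_mx_diag.
apply/matrixP => a b; rewrite !mxE !eqxx !mulr1n.
have [->|] := eqVneq a j; last by rewrite !mulr0 mul0r.
by have [->|] := eqVneq b k; rewrite ?mulr0 ?mul0r ?mulr1.
Qed.

Lemma mxtrace_delta (i j : 'I_m) : \tr (E i j) = (i == j)%:R.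
Proof.
rewrite /mxtrace (bigD1 i) //= !mxE eqxx big1 ?addr0 // => k /negPf ki.
by rewrite !mxE ki.
Qed.

Lemma delta_mx_neq0 (i j : 'I_m) : E i j != 0.
Proof.
by apply/eqP => /matrixP /(_ i j); rewrite !mxE !eqxx => /eqP; rewrite oner_eq0.
Qed.

Lemma br_delta_diag (i j k : 'I_m) :
  br (E i i) (E j k) = ((j == i)%:R - (k == i)%:R) *: E j k.
Proof.
rewrite /br !mul_delta scalerBl !scaler_nat (eq_sym i j).
by congr (_ - _); case: eqP => // ->.
Qed.

End MatrixUnits.

(** * Cartan subalgebras of sl contain a full diagonal torus *)

Section CartanOfSl.

Variables (F : fieldType) (n : nat).
Hypothesis splitF : splits_polys F.
Hypothesis char0F : [pchar F] =i pred0.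
Notation sln := (sl F n.+1).
Variable H : {vspace sln}.
Hypothesis cartanH : cartan H.
Implicit Types (A B X p q : 'M[F]_n.+1) (h x : sln).

(** The coercions between sl and matrices are named so that all products are formed
in one and the same matrix ring. *)
Definition slmx x : 'M[F]_n.+1 := vsval x.
Definition mxsl A : sln := vsproj (slv F n.+1) A.

Lemma sl_tr0 x : \tr (slmx x) = 0.
Proof. by apply/eqP; rewrite -mem_slv subvsP. Qed.

Lemma mxslK A : \tr A = 0 -> slmx (mxsl A) = A.
Proof. by move=> trA; rewrite /slmx vsprojK // mem_slv trA. Qed.

Lemma slmx_inj : injective slmx. Proof. exact: val_inj. Qed.

Lemma slmx0 : slmx 0 = 0. Proof. by []. Qed.

Lemma slmx_lie x y : slmx (lie x y) = br (slmx x) (slmx y).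
Proof. by []. Qed.

Lemma slmx_iter_lie k x y :
  slmx (iter k (lie x) y) = iter k (br (slmx x)) (slmx y).
Proof. by elim: k => //= k <-. Qed.

Definition centralizes A := forall h, h \in H -> slmx h * A = A * slmx h.

Lemma centralizes_scalar c : centralizes c%:M.
Proof. by move=> h _; rewrite -!mulmxE scalar_mxC. Qed.

Lemma centralizes_sub A B : centralizes A -> centralizes B -> centralizes (A - B).
Proof. by move=> cA cB h hH; rewrite mulrBr mulrBl cA ?cB. Qed.

Lemma centralizes_mul A B : centralizes A -> centralizes B -> centralizes (A * B).
Proof. by move=> cA cB h hH; rewrite mulrA cA // -mulrA cB // mulrA. Qed.

Definition traceless A : 'M[F]_n.+1 := A - (\tr A / n.+1%:R)%:M.

Lemma tr_traceless A : \tr (traceless A) = 0.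
Proof.
rewrite /traceless linearB /= mxtrace_scalar -[_ *+ _]mulr_natr divfK ?subrr //.
by rewrite ((pcharf0P _).1 char0F).
Qed.

(** A matrix commuting with H normalizes H. *)
Lemma centralizer_in_cartan A :
  centralizes A -> mxsl (traceless A) \in H.
Proof.
move=> cA; case: cartanH => _ _; apply=> h hH.
have -> : lie (mxsl (traceless A)) h = 0; last exact: mem0v.
apply: slmx_inj; rewrite slmx0 slmx_lie mxslK ?tr_traceless //.
apply/br_eq0; apply/esym.
by apply: centralizes_sub => //; apply: centralizes_scalar.
Qed.

Lemma centralizer_commutes A B : centralizes A -> centralizes B -> A * B = B * A.
Proof.
move=> cA cB; have /cB := centralizer_in_cartan cA.
rewrite mxslK ?tr_traceless // => /br_eq0.
by rewrite br_scalarB => /br_eq0.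
Qed.

Lemma cartan_nilpotent h x : h \in H -> x \in H ->
  exists k, iter k (br (slmx h)) (slmx x) = 0.
Proof.
case: cartanH => _ [k Hk] _ hH xH; exists k; rewrite -slmx_iter_lie.
have := iter_lie_lower_central k hH xH; rewrite Hk memv0 => /eqP ->.
exact: linear0.
Qed.

(** Take an eigenvalue c of h on the image of p.  The spectral projection e of h at c
centralizes H, because h is ad-nilpotent on H; so e p is 0 or p by primitivity,
and it fixes an eigenvector lying in the image of p. *)
Lemma primitive_eigenvalue p h : primitive centralizes p -> h \in H ->
  exists c k, (slmx h - c%:M) ^+ k * p = 0.
Proof.
case=> pp cp p0 p_prim hH; set A := slmx h.
have pA : A * p = p * A by apply: cp.
have row_p0 : nz_row p != 0 by rewrite nz_row_eq0.
have [c [q [w0 wA]]] := eigenvector_in_orbit A splitF row_p0.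
set w := nz_row p *m _ in w0 wA.
have hornerC (q' : {poly F}) B : A * B = B * A -> horner_mx A q' * B = B * horner_mx A q'.
  by move=> AB; apply: comm_horner_mx.
have wp : w *m p = w.
  have /submxP[u uE] := nz_row_sub p.
  by rewrite /w uE -!mulmxA !mulmxE hornerC // mulrA pp.
have [q' /= [ee [k ek] we]] := spectral_idempotent A c.
set e := horner_mx A q' in ee ek we.
have pe : p * e = e * p by apply/esym/hornerC.
exists c, k; suff <- : e * p = p by rewrite mulrA ek mul0r.
have [||||ep0|//] := p_prim (e * p).
- apply: centralizes_mul => // a aH; have [j aj] := cartan_nilpotent hH aH.
  by apply/esym/(idempotent_commutes ee _ aj) => Y; apply: hornerC.
- by rewrite -mulrA [p * _]mulrA pe -[e * p * p]mulrA pp mulrA ee.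
- by rewrite -mulrA pp.
- by rewrite mulrA pe -mulrA pp.
by case/eqP: w0; rewrite -wp -(we _ wA) -mulmxA mulmxE ep0 mulmx0.
Qed.

Lemma primitive_block_in_cartan p X : primitive centralizes p ->
  p * X * p = X -> \tr X = 0 -> mxsl X \in H.
Proof.
move=> p_prim pXp trX; have [pp cp _ _] := p_prim.
pose block x := p * slmx x * p = slmx x.
apply: (@cartan_absorbs _ _ H block) => //; last by rewrite /block mxslK.
  move=> a x aH xb; rewrite /block slmx_lie -[in RHS]xb /br mulrBr mulrBl.
  by rewrite !mulrA (cp a aH) -!mulrA (cp a aH).
move=> a x aH xb; have [c [k ak]] := primitive_eigenvalue p_prim aH.
exists (k + k)%N; suff -> : iter (k + k) (lie a) x = 0 by apply: mem0v.
apply: slmx_inj; rewrite slmx0 slmx_iter_lie.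
have pak : p * (slmx a - c%:M) ^+ k = 0.
  rewrite -ak; apply: commrX; apply/esym.
  by rewrite mulrBl mulrBr cp // -!mulmxE scalar_mxC.
rewrite -[RHS](iter_br_eq0 ak pak xb); apply: eq_iter => Y.
by rewrite br_scalarB.
Qed.

(** If a diagonalized primitive idempotent D had two diagonal entries 1, at j and a,
then E_ja and h = E_jj - E_aa would lie in H with [h, E_ja] = 2 E_ja, against
nilpotency.  So every D is a single E_jj. *)
Theorem cartan_contains_torus :
  exists2 P : 'M[F]_n.+1, P \in unitmx
    & forall j, mxsl (conj_by P (traceless (delta_mx j j))) \in H.
Proof.
have c1 : centralizes 1 by apply: centralizes_scalar.
have [ps psP ps1] :=
  primitive_decomposition centralizes_sub c1 (mulr1 1).
have [P Punit /allP Pdiag] : codiagonalizable ps.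
  apply/codiagonalizableP; split=> [A B /psP[_ cA _ _] /psP[_ cB _ _]|A /psP[AA _ _ _]].
    exact: centralizer_commutes.
  exact: idem_diagonalizable.
exists P => // j.
have [p p_ps Dj0] : exists2 p, p \in ps & (P *m p *m invmx P) j j != 0.
  apply: contrapT => no_p; have := oner_neq0 F; apply/negP; rewrite negbK.
  have : (P *m 1%:M *m invmx P) j j = 1 by rewrite mulmx1 mulmxV // mxE eqxx.
  rewrite -[1%:M in LHS]ps1 mulmx_sumr mulmx_suml summxE big_seq big1 => [<- //|p p_ps].
  by apply: contrapT => /eqP Dj0; apply: no_p; exists p.
have p_prim := psP p p_ps; have [pp cp _ _] := p_prim.
set D := P *m p *m invmx P in Dj0.
have Ddiag : is_diag_mx D 
  by apply/is_diag_mxP/diagonalizable_forP => //; apply: Pdiag.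
have pD : p = conj_by P D by rewrite conj_by_inv.
have DD : D * D = D by apply: (conj_by_inj Punit); rewrite -conj_byM // -pD.
move: D Dj0 Ddiag pD DD => D Dj0 Ddiag pD DD.
have D1 k : D k k != 0 -> D k k = 1.
  have /diag_mxP[d DE] := Ddiag => Dk0; apply: (mulfI Dk0); rewrite mulr1.
  by rewrite -{3}DD DE -mulmxE mul_diag_mx !mxE eqxx !mulr1n.
suff DE : D = delta_mx j j.
  rewrite -DE; suff -> : conj_by P (traceless D) = traceless p.
    exact: centralizer_in_cartan.
  rewrite /traceless linearB /= -pD pD mxtrace_conj_by //; congr (_ - _).
  by rewrite /conj_by -!mulmxE mul_mx_scalar -scalemxAl mulVmx // scalemx1.
apply/matrixP => a b; rewrite [RHS]mxE.
have [<-|ab] := eqVneq a b; last first.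
  have /diag_mxP[d DE] := Ddiag; rewrite DE mxE (negPf ab).
  by have [<-|] := eqVneq a j; rewrite // eq_sym (negPf ab).
rewrite andbb; have [->|aj] := eqVneq a j; first exact: D1.
apply/eqP/idPn => Da0.
have blockH X : D * X * D = X -> \tr X = 0 -> mxsl (conj_by P X) \in H.
  move=> DXD trX; apply: (primitive_block_in_cartan p_prim).
    by rewrite pD !conj_byM // DXD.
  by rewrite mxtrace_conj_by.
have xH : mxsl (conj_by P (delta_mx j a)) \in H.
  apply: blockH; first by rewrite mul_diag_delta_diag // (D1 j Dj0) (D1 a Da0) mulr1 scale1r.
  by rewrite mxtrace_delta eq_sym (negPf aj).
have hH : mxsl (conj_by P (delta_mx j j - delta_mx a a)) \in H.
  apply: blockH.
    rewrite mulrBr mulrBl !mul_diag_delta_diag //.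
    by rewrite (D1 j Dj0) (D1 a Da0) mulr1 !scale1r.
  by rewrite linearB /= !mxtrace_delta !eqxx subrr.
have [k] := cartan_nilpotent hH xH.
rewrite !mxslK; last first.
- by rewrite mxtrace_conj_by // linearB /= !mxtrace_delta !eqxx subrr.
- by rewrite mxtrace_conj_by // mxtrace_delta eq_sym (negPf aj).
have -> i : iter i (br (conj_by P (delta_mx j j - delta_mx a a)))
    (conj_by P (delta_mx j a)) = conj_by P (2%:R ^+ i *: delta_mx j a).
  elim: i => [|i IHi] /=; first by rewrite expr0 scale1r.
  rewrite IHi -conj_by_br // linearZ /=; congr (conj_by P _).
  rewrite brDl brNl !br_delta_diag !eqxx (negPf aj) eq_sym (negPf aj) -scalerBl.
  by rewrite scalerA exprSr; congr (_ * _ *: _); rewrite /=; ring.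
rewrite -(linear0 (conj_by P)) => /(conj_by_inj Punit) /eqP.
rewrite scaler_eq0 (negPf (delta_mx_neq0 _ _ _)) orbF expf_eq0.
by rewrite ((pcharf0P _).1 char0F) andbF.
Qed.

End CartanOfSl.

(** * Linear conditions on matrices and generation of sl *)

Section LinearClosure.

Variables (F : fieldType) (V : lmodType F).

(** Subspaces are handled as predicates, since the ones below are cut out by
commutation conditions. *)
Definition linear_pred (U : V -> Prop) : Prop :=
  U 0 /\ forall c x y, U x -> U y -> U (c *: x + y).

Lemma linear_predD U x y : linear_pred U -> U x -> U y -> U (x + y).
Proof. by case=> _ UP Ux Uy; rewrite -[x]scale1r; apply: UP. Qed.

Lemma linear_predZ U c x : linear_pred U -> U x -> U (c *: x).
Proof. by case=> U0 UP Ux; rewrite -[_ *: _]addr0; apply: UP. Qed.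

Lemma linear_predB U x y : linear_pred U -> U x -> U y -> U (x - y).
Proof.
by move=> [_ UP] Ux Uy; rewrite -scaleN1r addrC; apply: UP.
Qed.

Lemma linear_pred_sum U (I : Type) (s : seq I) (P : pred I) (f : I -> V) :
  linear_pred U -> (forall i, P i -> U (f i)) -> U (\sum_(i <- s | P i) f i).
Proof.
move=> linU Uf; apply: big_ind => //; first by case: linU.
by move=> x y; apply: linear_predD.
Qed.

End LinearClosure.

Section Generation.

Variables (F : fieldType) (n : nat).
Notation E i j := (delta_mx i j : 'M[F]_n.+1).

Lemma br_delta (i j k : 'I_n.+1) : i != k -> br (E i j) (E j k) = E i k.
Proof. by move=> ik; rewrite /br !mul_delta eqxx eq_sym (negPf ik) subr0. Qed.

Lemma br_delta_opp (i j : 'I_n.+1) : br (E i j) (E j i) = E i i - E j j.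
Proof. by rewrite /br !mul_delta !eqxx. Qed.

(** Root vectors along a path multiply up: [E_ij, E_jk] = E_ik.  Opposite root vectors
then give the differences of the E_ii, which span the traceless diagonal. *)
Lemma traceless_generated (K : 'M[F]_n.+1 -> Prop) (e : rel 'I_n.+1) :
    linear_pred K -> (forall A B, K A -> K B -> K (br A B)) ->
    (forall i j, e i j -> i != j -> K (E i j)) -> (forall i j, connect e i j) ->
  forall X, \tr X = 0 -> K X.
Proof.
move=> linK Kbr Ke e_conn X trX.
have KE i j : i != j -> K (E i j).
  have /connectP[s e_s ->] := e_conn i j.
  elim: s i e_s => [|k s IHs] i /=; first by rewrite eqxx.
  set l := last k s => /andP[e_ik e_s] il.
  have [lk|kl] := eqVneq l k; first by rewrite lk in il *; apply: Ke.
  have [ik|ik] := eqVneq i k; first by rewrite ik in il *; apply: IHs.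
  rewrite -(br_delta k il); apply: Kbr; first exact: Ke.
  by apply: IHs => //; rewrite eq_sym.
have KH i : K (E i i - E 0 0).
  have [->|i0] := eqVneq i 0; first by rewrite subrr; case: linK.
  by rewrite -br_delta_opp; apply: Kbr; apply: KE; rewrite // eq_sym.
have -> : X = \sum_i \sum_j X i j *: (E i j - (i == j)%:R *: E 0 0).
  have rowE i : \sum_j X i j *: (E i j - (i == j)%:R *: E 0 0)
      = \sum_j X i j *: E i j - X i i *: E 0 0.
    under eq_bigr => j _ do rewrite scalerBr scalerA.
    rewrite sumrB -scaler_suml; congr (_ - _ *: _).
    rewrite (bigD1 i) //= eqxx mulr1 big1 ?addr0 // => j /negPf ji.
    by rewrite eq_sym ji mulr0.
  under eq_bigr => i _ do rewrite rowE.
  by rewrite sumrB -scaler_suml -/(\tr X) trX scale0r subr0 -matrix_sum_delta.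
do 2![apply: linear_pred_sum => // ? _]; apply: linear_predZ => //.
case: eqVneq => [->|/KE]; first by rewrite scale1r.
by rewrite scale0r subr0.
Qed.

End Generation.

(** * Weight components and idempotents of graded matrix algebras *)

Section WeightComponents.

Variables (F : fieldType) (m : nat) (I : finType) (w : 'I_m -> I -> F).
Implicit Types (X Y : 'M[F]_m) (g : {ffun I -> F}).

Definition weight_mx i : 'M[F]_m := diag_mx (\row_a w a i).

Definition weight_diff a b : {ffun I -> F} := [ffun i => w a i - w b i].

Definition weight_comp g X : 'M[F]_m :=
  \matrix_(a, b) (X a b *+ (weight_diff a b == g)).

Lemma br_weight_mxE i X a b : br (weight_mx i) X a b = weight_diff a b i * X a b.
Proof.
by rewrite /br -!mulmxE mul_diag_mx mul_mx_diag !mxE ffunE mulrBl [X a b * _]mulrC.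
Qed.

(** The bracket with a diagonal matrix multiplies the entry (a, b) by a weight
difference.  The indicator function of a given weight is a polynomial in these
multipliers, by Lagrange interpolation, so a subspace stable under the brackets
is stable under weight components. *)
Lemma weight_comp_in (U : 'M[F]_m -> Prop) g X :
    linear_pred U -> (forall i Y, U Y -> U (br (weight_mx i) Y)) ->
  U X -> U (weight_comp g X).
Proof.
move=> linU Ubr UX.
pose had (h : 'I_m -> 'I_m -> F) Y := \matrix_(a, b) (h a b * Y a b) : 'M[F]_m.
pose good h := forall Y, U Y -> U (had h Y).
have good1 : good (fun _ _ => 1).
  move=> Y UY; suff -> : had (fun _ _ => 1) Y = Y by [].
  by apply/matrixP => a b; rewrite mxE mul1r.
have goodP (J : Type) (s : seq J) (P : pred J) (h : J -> 'I_m -> 'I_m -> F) :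
    (forall j, good (h j)) -> good (fun a b => \prod_(j <- s | P j) h j a b).
  move=> gh Y UY; elim: s => [|j s IHs].
    suff -> : had (fun a b => \prod_(j <- [::] | P j) h j a b) Y = Y by [].
    by apply/matrixP => a b; rewrite mxE big_nil mul1r.
  set Z := had _ _ in IHs; pose f := if P j then h j else fun _ _ => 1.
  suff -> : had (fun a b => \prod_(j <- j :: s | P j) h j a b) Y = had f Z.
    by rewrite /f; case: (P j); [apply: gh | apply: good1].
  apply/matrixP => a b; rewrite !mxE big_cons /f mulrA.
  by case: (P j); rewrite ?mul1r.
have good_lin i c d : good (fun a b => (weight_diff a b i - c) / d).
  move=> Y UY.
  suff -> : had (fun a b => (weight_diff a b i - c) / d) Y
      = d^-1 *: br (weight_mx i) Y - (c / d) *: Y.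
    by apply: linear_predB => //; apply: linear_predZ => //; apply: Ubr.
  apply/matrixP => a b; have := br_weight_mxE i Y a b.
  by move: (br _ _) => Z ZE; rewrite !mxE ZE; ring.
(* L is the interpolation product: one factor for each coordinate i and each pair of
   indices whose weight difference disagrees with g at i. *)
pose L a b := \prod_i \prod_(ab : 'I_m * 'I_m | weight_diff ab.1 ab.2 i != g i)
   ((weight_diff a b i - weight_diff ab.1 ab.2 i)
     / (g i - weight_diff ab.1 ab.2 i)).
have gL : good L by do 2![apply/goodP => ?]; apply: good_lin.
suff -> : weight_comp g X = had L X by apply: gL.
apply/matrixP => a b; rewrite !mxE /L.
have [ab_g|/eqP/ffunP] := eqVneq (weight_diff a b) g.
  rewrite big1 ?mul1r // => i _; rewrite big1 // => ab.
  by rewrite ab_g => gi; rewrite divff // subr_eq0 eq_sym.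
move=> ne; have [i ab_i] : exists i, weight_diff a b i != g i.
  by apply: contrapT => noi; apply: ne => i; apply: contrapT => /eqP ?; apply: noi; exists i.
by rewrite (bigD1 i) //= (bigD1 (a, b)) //= subrr !mul0r.
Qed.

End WeightComponents.

Section GradedIdempotents.

Variables (F : fieldType) (m : nat) (I : finType) (w : 'I_m.+1 -> I -> F).
Hypothesis char0F : [pchar F] =i pred0.
Variable A : 'M[F]_m.+1 -> Prop.
Hypothesis linA : linear_pred A.
Hypothesis A_mul : forall X Y, A X -> A Y -> A (X * Y).
Hypothesis A_br : forall i X, A X -> A (br (weight_mx w i) X).
Hypothesis A0_scalar : forall X,
  A X -> (forall i, br (weight_mx w i) X = 0) -> exists c, X = c%:M.
Implicit Types (X Y : 'M[F]_m.+1) (g : {ffun I -> F}).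
Notation comp := (weight_comp w).
Notation wd := (weight_diff w).

Lemma weight_comp_sum X :
  X = \sum_(g <- undup [seq wd ab.1 ab.2 | ab : 'I_m.+1 * 'I_m.+1]) comp g X.
Proof.
apply/matrixP => a b; rewrite summxE.
have ab_in : wd a b \in undup [seq wd ab.1 ab.2 | ab : 'I_m.+1 * 'I_m.+1].
  by rewrite mem_undup; apply/codomP; exists (a, b).
rewrite (bigD1_seq (wd a b)) ?undup_uniq //= mxE eqxx big1 ?addr0 // => g.
by rewrite mxE eq_sym => /negPf ->.
Qed.

Lemma br_weight_comp i g X : br (weight_mx w i) (comp g X) = g i *: comp g X.
Proof.
apply/matrixP => a b; rewrite br_weight_mxE !mxE.
by have [->|] := eqVneq (wd a b) g; rewrite ?mulr0.
Qed.

Lemma weight_diffD a b c : wd a b + wd b c = wd a c.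
Proof. by apply/ffunP => i; rewrite !ffunE addrA subrK. Qed.

Lemma weight_comp0_mul g X Y : comp 0 (comp g X * Y) = comp g X * comp (- g) Y.
Proof.
apply/matrixP => a c; rewrite -!mulmxE !mxE -sumrMnl; apply: eq_bigr => b _.
rewrite !mxE; have [ab_g|] := eqVneq (wd a b) g; last by rewrite !mul0r mul0rn.
rewrite -(weight_diffD a b c) ab_g addrC addr_eq0.
by case: eqP; rewrite ?mulr0.
Qed.

Lemma mxtrace_weight_comp0 X : \tr (comp 0 X) = \tr X.
Proof.
apply: eq_bigr => a _; rewrite mxE.
have -> : wd a a = 0 by apply/ffunP => i; rewrite !ffunE subrr.
by rewrite eqxx.
Qed.

Lemma weight_comp0_scalar X : A X -> exists c, comp 0 X = c%:M.
Proof.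
move=> AX; apply: A0_scalar => [|i]; first exact: weight_comp_in.
by rewrite br_weight_comp ffunE scale0r.
Qed.

Lemma natr_size_neq0 : m.+1%:R != 0 :> F.
Proof. by rewrite ((pcharf0P _).1 char0F). Qed.

(** Let x and y have opposite weights g and -g.  Then x y and y x are scalars of the
same trace, hence equal to one scalar c.  With D the torus element where g does
not vanish, g(D) x y = [D, x] y = D (x y) - x D y has trace
c tr D - tr (D y x) = 0, so c = 0. *)
Lemma mxtrace_weight_comp_mul g X Y : A X -> A Y -> g != 0 -> \tr (comp g X * Y) = 0.
Proof.
move=> AX AY; pose x := comp g X; pose y := comp (- g) Y.
have Ax : A x by apply: weight_comp_in.
have Ay : A y by apply: weight_comp_in.
have y0 : comp 0 (y * x) = y * x.
  rewrite weight_comp0_mul; congr (_ * _); apply/matrixP => a b.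
  by rewrite !mxE opprK -mulrnA mulnb andbb.
have [c xyE] := weight_comp0_scalar (A_mul Ax AY).
have [c' yxE] := weight_comp0_scalar (A_mul Ay Ax).
rewrite -mxtrace_weight_comp0 -/x xyE mxtrace_scalar => g0.
rewrite weight_comp0_mul -/x -/y in xyE; rewrite y0 in yxE.
have cc' : c = c'.
  have := mxtrace_mulC x y; rewrite !mulmxE xyE yxE !mxtrace_scalar => /eqP.
  rewrite -[c *+ _]mulr_natr -[c' *+ _]mulr_natr -subr_eq0 -mulrBl.
  rewrite mulf_eq0 (negPf natr_size_neq0) orbF.
  by rewrite subr_eq0 => /eqP.
have [i gi] : exists i, g i != 0.
  apply: contrapT => noi; case/eqP: g0; apply/ffunP => i; rewrite ffunE.
  by apply: contrapT => /eqP gi; apply: noi; exists i.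
have [D DE] : exists D, D = weight_mx w i by eexists.
have : \tr (br D x * y) = 0.
  rewrite /br mulrBl -!mulrA xyE linearB /= -!mulmxE [X in _ - X]mxtrace_mulC.
  by rewrite -mulmxA !mulmxE yxE cc' subrr.
rewrite DE br_weight_comp -mulmxE -scalemxAl mulmxE -/x xyE linearZ /=.
by move/eqP; rewrite mulf_eq0 (negPf gi) /= mxtrace_scalar => /eqP.
Qed.

(** Let c be the scalar weight 0 component of p.  By the previous lemma
tr p = tr (p p) = c tr p, so c = 1 or tr p = 0.  As tr p is also c times the
size of the matrices, and the trace of an idempotent is its rank, p has full or
zero rank. *)
Theorem graded_idempotent p : A p -> p * p = p -> p = 0 \/ p = 1.
Proof.
move=> Ap pp; have [c p0E] := weight_comp0_scalar Ap.
have trp : \tr p = c * m.+1%:R.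
  by rewrite -mxtrace_weight_comp0 p0E mxtrace_scalar mulr_natr.
have : \tr (p * p) = c * \tr p.
  rewrite {1}(weight_comp_sum p) mulr_suml linear_sum /=.
  rewrite (bigD1_seq 0) ?undup_uniq //=; last first.
    rewrite mem_undup; apply/codomP; exists (0, 0) => /=.
    by apply/ffunP => i; rewrite !ffunE subrr.
  rewrite big1_seq ?addr0 => [|g /andP[g0 _]]; last exact: mxtrace_weight_comp_mul.
  by rewrite p0E -mulmxE mul_scalar_mx linearZ.
rewrite pp => /eqP; rewrite -subr_eq0 -{1}[\tr p]mul1r -mulrBl mulf_eq0.
rewrite (mxtrace_idem pp) in trp *.
case/orP=> [|]; last first.
  by rewrite ((pcharf0P _).1 char0F) mxrank_eq0 => /eqP; left.
rewrite subr_eq0 => /eqP c1; right.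
move: trp; rewrite -c1 mul1r => /eqP.
rewrite -subr_eq0; case: (ltnP (\rank p) m.+1) => [lt_p|].
  rewrite -opprB oppr_eq0 -natrB; last exact: ltnW.
  by rewrite ((pcharf0P _).1 char0F) subn_eq0 leqNgt lt_p.
rewrite row_leq_rank => /row_freeP[q pq] _; rewrite mulmxE in pq.
by rewrite -[p]mulr1 -[1]pq mulrA pp pq.
Qed.

End GradedIdempotents.

(** * Commutants in sl_2-modules *)

Section Sl2.

Variables (F : fieldType) (m : nat).
Hypothesis char0F : [pchar F] =i pred0.
Implicit Types (e f h v z : 'M[F]_m).

(** The characteristic polynomial of phi has finitely many roots. *)
Lemma eigenvectors_vanish (phi : {linear 'M[F]_m -> 'M[F]_m}) (v : nat -> 'M[F]_m)
    (a : nat -> F) :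
  injective a -> (forall k, phi (v k) = a k *: v k) -> exists k, v k = 0.
Proof.
move=> a_inj phi_v; apply: contrapT => v_neq0.
have eig k : root (char_poly (lin_mx phi)) (a k).
  rewrite -eigenvalue_root_char; apply/eigenvalueP; exists (mxvec (v k)).
    by rewrite mul_vec_lin phi_v linearZ.
  by rewrite mxvec_eq0; apply/eqP => vk0; apply: v_neq0; exists k.
set chi := char_poly _ in eig.
pose rs := map a (iota 0 (size chi)).
have chi0 : chi != 0 by apply/monic_neq0/char_poly_monic.
have rs_root : all (root chi) rs by apply/allP => _ /mapP[k _ ->].
have rs_uniq : uniq rs by rewrite map_inj_uniq ?iota_uniq.
by have := max_poly_roots chi0 rs_root rs_uniq; rewrite size_map size_iota ltnn.
Qed.

(** A vector killed by e in a finite-dimensional sl_2-module has nonnegative weight: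
for weight -2, e maps f^(k+1) v to -(k+1)(k+2) f^k v, so f^k v = 0 for some k
forces v = 0; and such a k exists because the f^k v have distinct weights. *)
Lemma sl2_no_negative_weight e f h v :
    br e f = h -> br h f = (- 2%:R) *: f ->
  br e v = 0 -> br h v = (- 2%:R) *: v -> v = 0.
Proof.
move=> ef hf ev hv; pose vk k := iter k (br f) v.
have vkS k : vk k.+1 = br f (vk k) by [].
have h_vk k : br h (vk k) = - (k.+1 * 2)%:R *: vk k.
  elim: k => [|k IHk] //; rewrite vkS br_jacobi hf brZl IHk linearZ -scalerDl.
  by rewrite -opprD -natrD.
have e_vk k : br e (vk k.+1) = - (k.+1 * k.+2)%:R *: vk k.
  elim: k => [|k IHk]; first by rewrite vkS br_jacobi ef ev linear0 addr0 hv.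
  rewrite [vk k.+2]vkS br_jacobi ef h_vk IHk linearZ /= -vkS -scalerDl.
  by rewrite -opprD -natrD; congr (- _%:R *: _); lia.
have [||k vk0] := @eigenvectors_vanish (br h) vk (fun k => - (k.+1 * 2)%:R).
- move=> i j /oppr_inj /eqP; rewrite -subr_eq0.
  wlog ij : i j / (i <= j)%N.
    case: (leqP i j) => [ij|/ltnW ji] wl; first exact: wl.
    by rewrite -oppr_eq0 opprB => /(wl _ _ ji).
  rewrite -oppr_eq0 opprB -natrB; last by lia.
  by rewrite ((pcharf0P _).1 char0F) => /eqP; lia.
- exact: h_vk.
elim: k vk0 => // k IHk vk0; apply: IHk; have := e_vk k; rewrite vk0 linear0.
move/esym/eqP; rewrite scaler_eq0 oppr_eq0 ((pcharf0P _).1 char0F) /=.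
by move=> /eqP.
Qed.

(** In the adjoint module, [f, z] is killed by e and has weight -2. *)
Lemma sl2_commutant e f h z :
    br e f = h -> br h f = (- 2%:R) *: f ->
  e * z = z * e -> h * z = z * h -> f * z = z * f.
Proof.
move=> ef hf /br_eq0 ez /br_eq0 hz; apply/br_eq0.
apply: (sl2_no_negative_weight ef hf).
  by rewrite br_jacobi ef hz ez linear0 addr0.
by rewrite br_jacobi hf brZl hz linear0 addr0.
Qed.

End Sl2.

(** * Torus-stable subspaces acting on simple modules *)

Section RegularSubspaces.

Variables (F : fieldType) (n : nat).
Hypothesis char0F : [pchar F] =i pred0.
Notation E i j := (delta_mx i j : 'M[F]_n.+1).
Variable S : 'M[F]_n.+1 -> Prop.
Hypothesis linS : linear_pred S.
Hypothesis S_tr : forall X, S X -> \tr X = 0.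
Hypothesis S_torus : forall i X, S X -> S (br (E i i) X).

Lemma weight_mx_delta i : weight_mx (fun a i : 'I_n.+1 => (a == i)%:R) i = E i i.
Proof.
apply/matrixP => a b; rewrite !mxE; case: (eqVneq a b) => [<-|ab].
  by rewrite andbb mulr1n.
by rewrite mulr0n; case: eqP => //= <-; rewrite eq_sym (negPf ab).
Qed.

Lemma natr_bool_sub1 (x y : bool) : x%:R - y%:R = 1 :> F -> x.
Proof.
have n0 : (2%:R : F) != 0 by rewrite ((pcharf0P _).1 char0F).
case: x y => [] [] // /eqP; first by rewrite sub0r eq_sym -addr_eq0 (negPf n0).
by rewrite subr0 eq_sym oner_eq0.
Qed.

(** In characteristic 0 the weight space of gl for the root (j, k) is the line of
E_jk, so X_jk E_jk is a weight component of X. *)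
Lemma root_vector_in X j k : S X -> j != k -> X j k != 0 -> S (E j k).
Proof.
move=> SX jk Xjk; pose w (a i : 'I_n.+1) : F := (a == i)%:R.
have root_inj a b : weight_diff w a b = weight_diff w j k -> (a == j) && (b == k).
  move=> /ffunP wE; have := wE k; have := wE j.
  have kj : k == j = false by rewrite eq_sym (negPf jk).
  rewrite !ffunE /w !eqxx (negPf jk) kj subr0 sub0r.
  move=> /natr_bool_sub1 -> /(congr1 -%R); rewrite opprK opprB.
  exact: natr_bool_sub1.
have : S (weight_comp w (weight_diff w j k) X).
  by apply: weight_comp_in => // i Y SY; rewrite weight_mx_delta; apply: S_torus.
suff -> : weight_comp w (weight_diff w j k) X = X j k *: E j k.
  by move/(linear_predZ (X j k)^-1 linS); rewrite scalerK.
apply/matrixP => a b; rewrite !mxE.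
have [/root_inj /[dup] ab /andP[/eqP -> /eqP ->]|] := eqVneq.
  by rewrite !eqxx mulr1.
by case: (eqVneq a j) => [->|]; case: (eqVneq b k) => [->|]; rewrite ?eqxx ?mulr0.
Qed.

Variables (m : nat) (r : {linear 'M[F]_n.+1 -> 'M[F]_m.+1}).
Hypothesis splitF : splits_polys F.
Hypothesis r_br : forall X Y,
  \tr X = 0 -> \tr Y = 0 -> r (br X Y) = br (r X) (r Y).

Lemma tr_delta_neq (i j : 'I_n.+1) : i != j -> \tr (E i j) = 0.
Proof. by move=> /negPf ij; rewrite mxtrace_delta ij. Qed.

Lemma br_traceless (A X : 'M[F]_n.+1) : br (traceless A) X = br A X.
Proof. exact: br_scalarB. Qed.

(** Edges of the graph whose connectedness decides between wide and narrow. *)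
Definition root_rel (i j : 'I_n.+1) : bool := `[< S (E i j) \/ S (E j i) >].

(** Here z is the traceless part of the projection on P; its spectral projection e
on V is neither 0, by the choice of an eigenvalue, nor 1: otherwise ad (r z)
would be nilpotent, killing each E_ij between P and its complement, on which
it acts by a nonzero scalar. *)
Lemma separated_has_idempotent (P : {pred 'I_n.+1}) i0 i1 :
    i0 \in P -> i1 \notin P ->
    (forall i j, root_rel i j -> (i \in P) = (j \in P)) ->
    (exists2 X, \tr X = 0 & r X != 0) ->
  exists e : 'M[F]_m.+1,
    [/\ e * e = e, e != 0, e != 1 & forall X, S X -> e * r X = r X * e].
Proof.
move=> i0P i1P P_rel [X0 trX0 rX0].
pose d i : F := (i \in P)%:R.
pose z := traceless (diag_mx (\row_i d i)); set Z := r z.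
have trz : \tr z = 0 by apply: tr_traceless.
have brz X a b : br z X a b = (d a - d b) * X a b.
  rewrite br_traceless -[diag_mx _]/(weight_mx (fun a (_ : 'I_1) => d a) ord0).
  by rewrite br_weight_mxE ffunE.
have ZS X : S X -> Z * r X = r X * Z.
  move=> SX; apply/br_eq0; rewrite -r_br // ?S_tr //.
  suff -> : br z X = 0 by rewrite linear0.
  apply/matrixP => a b; rewrite brz [RHS]mxE.
  have [->|Xab] := eqVneq (X a b) 0; first by rewrite mulr0.
  have [->|ab] := eqVneq a b; first by rewrite subrr mul0r.
  rewrite /d (P_rel a b) ?subrr ?mul0r //.
  by apply/asboolP; left; apply: root_vector_in Xab.
have [c [w [w0 wZ]]] := exists_eigenvector Z splitF.
have [q' /= [ee [k ek] ew]] := spectral_idempotent Z c.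
exists (horner_mx Z q'); split=> // [||X SX]; last 1 first.
- by apply: comm_horner_mx; apply: ZS.
- by apply: contraNneq w0 => e0; rewrite -(ew _ wZ) e0 mulmx0.
apply: contraNneq rX0 => e1; rewrite e1 mulr1 in ek.
have cross i j : (i \in P) != (j \in P) -> r (E i j) = 0.
  move=> ij_P; have ij : i != j by apply: contraNneq ij_P => ->.
  have rE : br Z (r (E i j)) = (d i - d j) *: r (E i j).
    rewrite -r_br ?tr_delta_neq // -linearZ; congr (r _).
    apply/matrixP => a b; rewrite brz !mxE.
    by case: (eqVneq a i) => [->|]; case: (eqVneq b j) => [->|]; rewrite ?mulr0.
  have /(_ (r (E i j))) : forall X : 'M[F]_m.+1, iter (k + k) (br (Z - c%:M)) X = 0.
    by move=> X; apply: (@iter_br_eq0 _ _ _ 1); rewrite ?mulr1 ?mul1r.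
  rewrite (eq_iter (br_scalarB c Z)).
  have -> t : iter t (br Z) (r (E i j)) = (d i - d j) ^+ t *: r (E i j).
    elim: t => [|t IHt] /=; first by rewrite expr0 scale1r.
    by rewrite IHt linearZ /= rE scalerA -exprSr.
  move/eqP; rewrite scaler_eq0 expf_eq0 => /orP[/andP[_]|/eqP //].
  rewrite /d; move: ij_P; case: (i \in P); case: (j \in P) => //= _.
    by rewrite subr0 oner_eq0.
  by rewrite sub0r oppr_eq0 oner_eq0.
pose K X := \tr X = 0 /\ r X = 0.
suff [_ ->] : K X0 by rewrite eqxx.
apply: (@traceless_generated _ _ K (fun i j => (i \in P) != (j \in P))) => //.
- split=> [|a X Y [tX rX] [tY rY]]; first by rewrite /K !linear0.
  by rewrite /K !linearP /= tX tY rX rY scaler0 addr0 mulr0 addr0.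
- move=> X Y [tX rX] [tY rY]; rewrite /K mxtrace_br r_br // rX rY.
  by rewrite linear0.
- by move=> i j ijP _; split; [apply: tr_delta_neq; apply: contraNneq ijP => -> | apply: cross].
move=> i j; have [ijP|] := boolP ((i \in P) != (j \in P)); first exact: connect1.
rewrite negbK => /eqP ijP; pose l := if i \in P then i1 else i0.
have lP : (l \in P) != (j \in P).
  by rewrite -ijP /l; case: ifP; rewrite ?(negPf i1P) ?i0P.
by apply: (connect_trans (y := l)); apply: connect1; rewrite ?ijP // eq_sym.
Qed.

Hypothesis r_simple : forall W : 'M[F]_m.+1,
  (forall X, \tr X = 0 -> stablemx W (r X)) -> W = 0 \/ (1%:M <= W)%MS.

(** Schur's lemma. *)
Lemma simple_commutant Z : (forall X, \tr X = 0 -> Z * r X = r X * Z) ->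
  exists c, Z = c%:M.
Proof.
move=> Zr.
have [c [w [w0 wZ]]] := exists_eigenvector Z splitF.
exists c; have [|W0|] := r_simple (W := eigenspace Z c).
- by move=> X trX; apply: comm_mx_stable_eigenspace (Zr X trX).
- move/eigenspaceP: wZ; rewrite W0 submx0 => w_eq0.
  by rewrite w_eq0 in w0.
- by move/eigenspaceP; rewrite mul1mx => ->; rewrite scalemx1.
Qed.

(** A root vector shifts eigenvalues of a torus element, so the sum of its
eigenspaces is a submodule; it is nonzero, hence everything. *)
Lemma torus_diagonalizable i : diagonalizable (r (traceless (E i i))).
Proof.
set T := r _; have [l chiE] := splitF (char_poly T).
rewrite (monicP (char_poly_monic T)) scale1r in chiE.
apply/diagonalizablePeigen; exists (undup l); first exact: undup_uniq.
set W := (\sum_(c <- _) _)%MS.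
have sW c : (eigenspace T c <= W)%MS.
  have [->|eig] := eqVneq (eigenspace T c) 0; first exact: sub0mx.
  have cl : c \in undup l.
    by rewrite mem_undup -root_prod_XsubC -chiE -eigenvalue_root_char.
  by rewrite /W (bigD1_seq c) ?undup_uniq //= addsmxSl.
pose K X := \tr X = 0 /\ stablemx W (r X).
have KP X : \tr X = 0 -> K X.
  apply: (@traceless_generated _ _ K (fun _ _ => true)) => //.
  - split=> [|c Y Z [tY rY] [tZ rZ]]; rewrite /K ?linear0 ?mulmx0 ?sub0mx //.
    rewrite !linearP /= tY tZ mulr0 addr0; split=> //.
    by rewrite addmx_sub ?scalemx_sub.
  - move=> Y Z [tY rY] [tZ rZ]; rewrite /K mxtrace_br r_br //; split=> //.
    rewrite /br -!mulmxE mulmxBr !mulmxA addmx_sub ?eqmx_opp //.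
      by rewrite (submx_trans (submxMr _ rY)).
    by rewrite (submx_trans (submxMr _ rZ)).
  - move=> j k _ jk; split; first exact: tr_delta_neq.
    have := br_delta_diag F i j k; move: (_ - _) => d brE.
    have brT : r (E j k) *m T = T *m r (E j k) - d *: r (E j k).
      rewrite -linearZ -brE -br_traceless r_br ?tr_traceless ?tr_delta_neq //.
      by rewrite /br !mulmxE opprB addrC subrK.
    rewrite {1}/W; elim: (undup l) => [|c s IHs]; first by rewrite big_nil mul0mx sub0mx.
    rewrite big_cons addsmxMr addsmx_sub IHs andbT.
    apply: submx_trans (sW (c - d)); apply/eigenspaceP.
    have /eigenspaceP cT := submx_refl (eigenspace T c).
    rewrite -mulmxA brT mulmxBr mulmxA cT -scalemxAl -scalemxAr.
    by rewrite scalerBl.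
  by move=> j k; apply: connect1.
have [X /KP[] //|W0|sW1] := r_simple (W := W); last first.
  by apply/eqmxP; rewrite submx1.
have [c [w [w0 wT]]] := exists_eigenvector T splitF.
have := sW c; rewrite W0 submx0 => /eqP eig0.
by move/eigenspaceP: wT; rewrite eig0 submx0 (negPf w0).
Qed.

Lemma root_commutant Z i j : i != j ->
    (forall k, Z * r (traceless (E k k)) = r (traceless (E k k)) * Z) ->
  Z * r (E i j) = r (E i j) * Z -> Z * r (E j i) = r (E j i) * Z.
Proof.
move=> ij ZT Zij; have ji : j != i by rewrite eq_sym.
have trH : \tr (E i i - E j j) = 0 by rewrite linearB /= !mxtrace_delta !eqxx subrr.
apply/esym/(sl2_commutant char0F (e := r (E i j)) (h := r (E i i - E j j))) => //.
- by rewrite -r_br ?tr_delta_neq // br_delta_opp.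
- rewrite -r_br ?tr_delta_neq // -linearZ; congr (r _).
  rewrite brDl brNl !br_delta_diag !eqxx (negPf ij) (negPf ji) -scalerBl.
  by congr (_ *: _); rewrite /=; ring.
have -> : E i i - E j j = traceless (E i i) - traceless (E j j).
  by rewrite /traceless !mxtrace_delta !eqxx opprB addrA subrK.
by rewrite linearB /= mulrBl mulrBr !ZT.
Qed.

(** Diagonalize the torus on V by Q and apply [graded_idempotent] to the commutant A of
S, transported to the new basis.  Its weight 0 elements commute with the torus
and with all root vectors along edges, in both directions, so they are scalars
by generation and Schur's lemma. *)
Lemma connected_idempotent p : (forall i j, connect root_rel i j) ->
    (forall X, S X -> p * r X = r X * p) -> p * p = p -> p = 0 \/ p = 1.
Proof.
move=> conn pS pp.
have [Q Qunit /allP Qdiag] :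
    codiagonalizable [seq r (traceless (E i i)) | i <- enum 'I_n.+1].
  apply/codiagonalizableP; split=> [_ _ /mapP[i _ ->] /mapP[j _ ->]|_ /mapP[i _ ->]].
    apply/br_eq0; rewrite -r_br ?tr_traceless // br_traceless.
    by rewrite brC br_traceless br_delta_diag subrr scale0r oppr0 linear0.
  exact: torus_diagonalizable.
have /fin_all_exists [d dE] i : exists d, r (traceless (E i i)) = conj_by Q (diag_mx d).
  have : is_diag_mx (Q *m r (traceless (E i i)) *m invmx Q).
    apply/is_diag_mxP/diagonalizable_forP => //; apply: Qdiag.
    by apply/mapP; exists i; rewrite ?mem_enum.
  by case/diag_mxP=> d dE; exists d; rewrite -dE conj_by_inv.
pose w a i : F := d i 0 a.
have wE i : conj_by Q (weight_mx w i) = r (traceless (E i i)).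
  rewrite dE /weight_mx; congr (conj_by Q (diag_mx _)).
  by apply/rowP => a; rewrite mxE.
pose A X := forall Y, S Y -> conj_by Q X * r Y = r Y * conj_by Q X.
have linA : linear_pred A.
  split=> [|c X X' AX AX'] Y SY; first by rewrite linear0 mul0r mulr0.
  rewrite linearP /= mulrDl mulrDr AX' // -!mulmxE -scalemxAl -scalemxAr !mulmxE.
  by rewrite AX.
have A_mul X X' : A X -> A X' -> A (X * X').
  by move=> AX AX' Y SY; rewrite -conj_byM // -mulrA AX' // [LHS]mulrA AX // -mulrA.
have A_br i X : A X -> A (br (weight_mx w i) X).
  move=> AX Y SY; rewrite conj_by_br // wE; apply/esym/br_eq0.
  have /br_eq0 XY : r Y * conj_by Q X = conj_by Q X * r Y by rewrite AX.
  have /br_eq0 XY' :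
      r (br (E i i) Y) * conj_by Q X = conj_by Q X * r (br (E i i) Y).
    by rewrite AX //; apply: S_torus.
  rewrite br_jacobi XY linear0 addr0 -r_br ?tr_traceless ?S_tr //.
  by rewrite [br Y _]brC br_traceless linearN brNl XY' oppr0.
have A0_scalar X : A X -> (forall i, br (weight_mx w i) X = 0) -> exists c, X = c%:M.
  move=> AX X0; set Z := conj_by Q X.
  have ZT k : Z * r (traceless (E k k)) = r (traceless (E k k)) * Z.
    by apply/esym/br_eq0; rewrite -wE -conj_by_br // X0 linear0.
  have [c ZE] : exists c, Z = c%:M.
    apply: simple_commutant => Y trY.
    pose K Y := \tr Y = 0 /\ Z * r Y = r Y * Z.
    suff [] : K Y by [].
    apply: (@traceless_generated _ _ K root_rel) => //.
    - split=> [|c U V [tU rU] [tV rV]]; rewrite /K; first by rewrite !linear0 mulr0 mul0r.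
      rewrite !linearP /= tU tV mulr0 addr0 mulrDl mulrDr rV.
      by rewrite -!mulmxE -scalemxAl -scalemxAr !mulmxE rU.
    - move=> U V [tU /br_eq0 rU] [tV /br_eq0 rV]; split; first exact: mxtrace_br.
      by apply/br_eq0; rewrite r_br // br_jacobi rU rV linear0 addr0 /br mul0r mulr0 subrr.
    move=> j k /asboolP[] SE jk; split; try exact: tr_delta_neq; first exact: AX.
    by apply: root_commutant; rewrite 1?eq_sym // AX.
  exists c; apply: (conj_by_inj Qunit); rewrite -/Z ZE.
  by rewrite /conj_by -!mulmxE mul_mx_scalar -scalemxAl mulVmx // scalemx1.
have Ap : A (Q *m p *m invmx Q) by move=> Y SY; rewrite conj_by_inv // pS.
have pp' : Q *m p *m invmx Q * (Q *m p *m invmx Q) = Q *m p *m invmx Q.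
  by apply: (conj_by_inj Qunit); rewrite -conj_byM // !conj_by_inv.
have [p0|p1] := graded_idempotent char0F linA A_mul A_br A0_scalar Ap pp'.
  by left; rewrite -(conj_by_inv Qunit p) p0 linear0.
right; rewrite -(conj_by_inv Qunit p) p1 /conj_by mulr1.
by rewrite -mulmxE mulVmx.
Qed.

End RegularSubspaces.

(** * From modules to matrices *)

Section Coordinates.

Variables (F : fieldType) (V : vectType F) (m : nat).
Variables (phi : {linear V -> 'rV[F]_m.+1}) (psi : {linear 'rV[F]_m.+1 -> V}).
Hypotheses (phiK : cancel phi psi) (psiK : cancel psi phi).
Implicit Types (f g : 'End(V)) (A W : 'M[F]_m.+1) (v : V).

Definition mx_of_end f : 'M[F]_m.+1 := lin1_mx (phi \o f \o psi).
Definition img_of_mx W : {vspace V} := limg (linfun (psi \o mulmxr W \o phi)).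

Lemma mul_mx_of_end u f : u *m mx_of_end f = phi (f (psi u)).
Proof. by rewrite mul_rV_lin1. Qed.

Lemma mulmx_rV_inj A B : (forall u : 'rV_m.+1, u *m A = u *m B) -> A = B.
Proof. by move=> AB; apply/row_matrixP => i; rewrite !rowE. Qed.

Lemma mx_of_end_comp f g : mx_of_end (f \o g)%VF = mx_of_end g * mx_of_end f.
Proof.
by apply: mulmx_rV_inj => u; rewrite -mulmxE mulmxA !mul_mx_of_end phiK lfunE.
Qed.

Fact mx_of_end_is_linear : linear mx_of_end.
Proof.
move=> c f g; apply: mulmx_rV_inj => u.
by rewrite mulmxDr -scalemxAr !mul_mx_of_end !lfunE /= !lfunE linearP.
Qed.
HB.instance Definition _ :=
  GRing.isLinear.Build F 'End(V) 'M[F]_m.+1 *:%R mx_of_end mx_of_end_is_linear.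

Lemma mx_of_end_inj : injective mx_of_end.
Proof.
move=> f g fg; apply/lfunP => v; rewrite -[v]phiK.
by apply: (can_inj phiK); rewrite -!mul_mx_of_end fg.
Qed.

Lemma memv_img_of_mx v W : (v \in img_of_mx W) = (phi v <= W)%MS.
Proof.
apply/memv_imgP/submxP => [[u _ ->]|[u vE]].
  by exists (phi u); rewrite lfunE /= psiK.
by exists (psi u); rewrite ?memvf // lfunE /= psiK -vE phiK.
Qed.

Lemma img_of_mx_stable f v W :
  stablemx W (mx_of_end f) -> v \in img_of_mx W -> f v \in img_of_mx W.
Proof.
rewrite !memv_img_of_mx => Wf vW; rewrite -[v in f v]phiK -mul_mx_of_end.
exact: submx_trans (submxMr _ vW) Wf.
Qed.

Lemma img_of_mx_eq0 W : (img_of_mx W == 0%VS) = (W == 0).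
Proof.
apply/eqP/eqP => [W0|->]; last first.
  apply/eqP; rewrite -subv0; apply/subvP => v.
  by rewrite memv_img_of_mx submx0 memv0 -(can_eq phiK) linear0.
apply: mulmx_rV_inj => u; rewrite mulmx0; apply: (can_inj psiK).
apply/eqP; rewrite linear0 -memv0 -W0 memv_img_of_mx psiK; exact: submxMl.
Qed.

End Coordinates.

Section BasisCoordinates.

Variables (F : fieldType) (V : vectType F).
Notation B := (vbasis {:V}).

Definition vcoords (v : V) : 'rV[F]_(\dim {:V}) := \row_i coord B i v.
Definition of_vcoords (u : 'rV[F]_(\dim {:V})) : V := \sum_i u 0 i *: B`_i.

Fact vcoords_is_linear : linear vcoords.
Proof. by move=> c u v; apply/rowP => i; rewrite !mxE linearP. Qed.
HB.instance Definition _ :=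
  GRing.isLinear.Build F V 'rV[F]_(\dim {:V}) *:%R vcoords vcoords_is_linear.

Fact of_vcoords_is_linear : linear of_vcoords.
Proof.
move=> c u v; rewrite /of_vcoords scaler_sumr -big_split /=.
by apply: eq_bigr => i _; rewrite !mxE scalerDl scalerA.
Qed.
HB.instance Definition _ :=
  GRing.isLinear.Build F 'rV[F]_(\dim {:V}) V *:%R of_vcoords of_vcoords_is_linear.

Lemma vcoordsK : cancel vcoords of_vcoords.
Proof.
move=> v; rewrite [RHS](coord_vbasis (memvf v)).
by apply: eq_bigr => i _; rewrite mxE.
Qed.

Lemma of_vcoordsK : cancel of_vcoords vcoords.
Proof.
move=> u; apply/rowP => i; rewrite mxE.
by rewrite coord_sum_free // (basis_free (vbasisP _)).
Qed.

End BasisCoordinates.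

Lemma exists_coordinates (F : fieldType) (V : vectType F) :
    (fullv != 0 :> {vspace V})%VS ->
  exists m (phi : {linear V -> 'rV[F]_m.+1}) (psi : {linear 'rV[F]_m.+1 -> V}),
    cancel phi psi /\ cancel psi phi.
Proof.
move=> V0.
have : exists m (phi : {linear V -> 'rV[F]_m}) (psi : {linear 'rV[F]_m -> V}),
    cancel phi psi /\ cancel psi phi.
  exists (\dim {:V}), (@vcoords F V : {linear _ -> _}).
  exists (@of_vcoords F V : {linear _ -> _}).
  by split; [apply: vcoordsK | apply: of_vcoordsK].
case=> [[|m]] [phi [psi [phiK psiK]]]; last by exists m, phi, psi.
case/eqP: V0; apply/eqP; rewrite -subv0; apply/subvP => v _.
by rewrite memv0 -[v]phiK (thinmx0 (phi v)) linear0.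
Qed.

Section Decompositions.

Variables (F : fieldType) (L : lieAlgType F) (V : vectType F) (m : nat).
Variables (rho : {linear L -> 'End(V)}) (S : {vspace L}).
Variables (phi : {linear V -> 'rV[F]_m.+1}) (psi : {linear 'rV[F]_m.+1 -> V}).
Hypotheses (phiK : cancel phi psi) (psiK : cancel psi phi).
Notation mx x := (mx_of_end phi psi (rho x)).

Lemma decomposable_of_idempotent (e : 'M[F]_m.+1) :
    e * e = e -> e != 0 -> e != 1 -> (forall x, x \in S -> e * mx x = mx x * e) ->
  decomposable rho S.
Proof.
move=> ee e0 e1 eS; pose img W := img_of_mx phi psi W.
have sub W : (forall x, x \in S -> W * mx x = mx x * W) -> submodule rho S (img W).
  move=> WS x v xS; apply: img_of_mx_stable => //.
  by rewrite mulmxE WS // -mulmxE submxMl.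
exists (img e), (img (1 - e)); split.
- split; apply: sub => // x xS.
  by rewrite mulrBl mulrBr mul1r mulr1 eS.
- by rewrite img_of_mx_eq0.
- by rewrite img_of_mx_eq0 // subr_eq0 eq_sym.
- apply/eqP; rewrite eqEsubv subvf; apply/subvP => v _.
  rewrite -[v]phiK -[phi v]mulmx1 -[1%:M](subrK e) addrC mulmxDr linearD /=.
  by rewrite memv_add // memv_img_of_mx // psiK submxMl.
apply/eqP; rewrite -subv0; apply/subvP => v; rewrite memv_cap !memv_img_of_mx //.
rewrite memv0 -(can_eq phiK) linear0 => /andP[/submxP[u uE] /submxP[w wE]].
have : phi v *m e = phi v by rewrite uE -mulmxA mulmxE ee.
by rewrite {1}wE -mulmxA mulmxE mulrBl mul1r ee subrr mulmx0 => <-.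
Qed.

Lemma idempotent_of_decomposable : decomposable rho S ->
  exists e : 'M[F]_m.+1, [/\ e * e = e, e != 0, e != 1
    & forall x, x \in S -> e * mx x = mx x * e].
Proof.
case=> W1 [W2 [[sub1 sub2] W1_0 W2_0 W12 W12_0]].
pose pi := daddv_pi W1 W2.
have pi_id v : v \in W1 -> pi v = v by apply: daddv_pi_id.
have piD v : pi v + daddv_pi W2 W1 v = v by apply: daddv_pi_add; rewrite // W12 memvf.
have pi0 v : v \in W2 -> pi v = 0.
  by move=> vW2; apply: (addIr (daddv_pi W2 W1 v)); rewrite piD add0r daddv_pi_id // capvC.
exists (mx_of_end phi psi pi); split.
- rewrite -mx_of_end_comp //; congr (mx_of_end _ _ _); apply/lfunP => v.
  by rewrite lfunE /= pi_id ?memv_pi.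
- apply: contraNneq W1_0 => e0; rewrite -subv0; apply/subvP => v vW1.
  suff <- : pi v = v by rewrite (mx_of_end_inj phiK (etrans e0 (esym (linear0 _)))) lfunE memv0.
  exact: pi_id.
- apply: contraNneq W2_0 => e1; rewrite -subv0; apply/subvP => v vW2.
  rewrite memv0 -(can_eq phiK) linear0 -[phi v]mulmx1 -[1%:M]e1.
  by rewrite mul_mx_of_end phiK pi0 // linear0.
move=> x xS; rewrite -!mx_of_end_comp //; congr (mx_of_end _ _ _); apply/lfunP => v.
rewrite !lfunE /= -{2}(piD v) !linearD /= [X in _ = _ + X]pi0 ?addr0.
  by rewrite [pi (rho x _)]pi_id // sub1 // memv_pi.
by rewrite sub2 // memv_pi.
Qed.

End Decompositions.

(** * Regular subalgebras of sl *)

Section RegularSubalgebras.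

Variables (F : fieldType) (n : nat).
Hypothesis splitF : splits_polys F.
Hypothesis char0F : [pchar F] =i pred0.
Notation sln := (sl F n.+1).
Variables (H s : {vspace sln}) (P : 'M[F]_n.+1).
Hypothesis Punit : P \in unitmx.
Hypothesis torus_in_H : forall j, mxsl (conj_by P (traceless (delta_mx j j))) \in H.
Hypothesis H_norm : normalizes H s.
Implicit Types (X Y : 'M[F]_n.+1) (x : sln).

(** X is the matrix of an element of sl in the basis where H contains the diagonal
torus. *)
Definition sl_of X : sln := mxsl (conj_by P X).

Fact sl_of_is_linear : linear sl_of.
Proof. by move=> c X Y; rewrite /sl_of /mxsl !linearP. Qed.
HB.instance Definition _ :=
  GRing.isLinear.Build F 'M[F]_n.+1 sln *:%R sl_of sl_of_is_linear.

Lemma slmx_sl_of X : \tr X = 0 -> slmx (sl_of X) = conj_by P X.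
Proof. by move=> trX; rewrite mxslK // mxtrace_conj_by. Qed.

Lemma sl_of_br X Y : \tr X = 0 -> \tr Y = 0 ->
  sl_of (br X Y) = lie (sl_of X) (sl_of Y).
Proof.
move=> trX trY; apply: slmx_inj.
by rewrite slmx_lie !slmx_sl_of ?mxtrace_br // conj_by_br.
Qed.

Lemma sl_of_surj x : exists2 X, \tr X = 0 & sl_of X = x.
Proof.
exists (P *m slmx x *m invmx P); first by rewrite mxtrace_mulC mulKmx // sl_tr0.
apply: slmx_inj; rewrite slmx_sl_of ?conj_by_inv //.
by rewrite mxtrace_mulC mulKmx // sl_tr0.
Qed.

Definition regular_pred X : Prop := \tr X = 0 /\ sl_of X \in s.

Lemma regular_pred_linear : linear_pred regular_pred.
Proof.
split=> [|c X Y [tX sX] [tY sY]]; rewrite /regular_pred.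
  by rewrite !linear0 mem0v.
by rewrite !linearP /= tX tY mulr0 addr0 rpredD ?rpredZ.
Qed.

Lemma regular_pred_torus i X : regular_pred X -> regular_pred (br (delta_mx i i) X).
Proof.
move=> [tX sX]; split; first exact: mxtrace_br.
rewrite -br_traceless sl_of_br ?tr_traceless //.
by apply: H_norm => //; apply: torus_in_H.
Qed.

Section Module.

Variables (V : vectType F) (rho : {linear sln -> 'End(V)}) (m : nat).
Variables (phi : {linear V -> 'rV[F]_m.+1}) (psi : {linear 'rV[F]_m.+1 -> V}).
Hypotheses (phiK : cancel phi psi) (psiK : cancel psi phi).
Hypothesis rho_rep : lie_rep rho.
Hypothesis rho_simple : simple_module rho.

(** Matrices act on row vectors, which reverses products; the sign turns the
resulting anti-homomorphism into a homomorphism of Lie algebras. *)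
Definition rep_mx X : 'M[F]_m.+1 := - mx_of_end phi psi (rho (sl_of X)).

Fact rep_mx_is_linear : linear rep_mx.
Proof. by move=> c X Y; rewrite /rep_mx !linearP. Qed.
HB.instance Definition _ :=
  GRing.isLinear.Build F 'M[F]_n.+1 'M[F]_m.+1 *:%R rep_mx rep_mx_is_linear.

Lemma rep_mx_br X Y : \tr X = 0 -> \tr Y = 0 ->
  rep_mx (br X Y) = br (rep_mx X) (rep_mx Y).
Proof.
move=> tX tY; rewrite /rep_mx sl_of_br // rho_rep linearB /= !mx_of_end_comp //.
by rewrite /br !mulrNN opprB.
Qed.

Lemma rep_mx_simple (W : 'M[F]_m.+1) : (forall X, \tr X = 0 -> stablemx W (rep_mx X)) ->
  W = 0 \/ (1%:M <= W)%MS.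
Proof.
move=> Wr; case: rho_simple => _ /(_ (img_of_mx phi psi W)) [x v _ vW||WT].
- apply: img_of_mx_stable => //; have [X tX <-] := sl_of_surj x.
  by have := Wr X tX; rewrite /rep_mx mulmxN eqmx_opp.
- by move/eqP; rewrite img_of_mx_eq0 // => /eqP; left.
right; apply/row_subP => i; by rewrite -[row i _]psiK -(memv_img_of_mx phiK) // WT memvf.
Qed.

Lemma commutes_rep_mx (e : 'M[F]_m.+1) :
  (forall x, x \in s -> e * mx_of_end phi psi (rho x) = mx_of_end phi psi (rho x) * e)
  <-> (forall X, regular_pred X -> e * rep_mx X = rep_mx X * e).
Proof.
split=> [es X [_ sX]|eS x xs]; first by rewrite /rep_mx mulrN mulNr es.
have [X tX xE] := sl_of_surj x.
have := eS X; rewrite /rep_mx mulrN mulNr xE => /(_ _)/oppr_inj; apply.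
by split; rewrite ?xE.
Qed.

End Module.

Lemma root_rel_sym : symmetric (root_rel regular_pred).
Proof. by move=> i j; apply/asboolP/asboolP => -[]; [right|left|right|left]. Qed.

(** A decomposition over s amounts to a nontrivial idempotent commuting with s, which
a connected graph excludes and a disconnected one provides. *)
Theorem torus_normalized_narrow_or_wide : narrow s \/ wide s.
Proof.
have S_tr X : regular_pred X -> \tr X = 0 by case.
have [conn|nconn] := pselect (forall i j, connect (root_rel regular_pred) i j).
  right=> V rho rho_rep rho_simple; split; first by case: rho_simple.
  have [m [phi [psi [phiK psiK]]]] := exists_coordinates rho_simple.1.
  case/(idempotent_of_decomposable phiK) => e [ee e0 e1 es].
  have [||] := connected_idempotent char0F S_tr
      regular_pred_torus splitF (rep_mx_br phiK rho_rep)
      (rep_mx_simple phiK psiK rho_simple) conn _ ee.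
  - exact/commutes_rep_mx.
  - by move/eqP; apply/negP.
  - by move/eqP; apply/negP.
left=> V rho rho_rep rho_simple [x [v xv]].
have [m [phi [psi [phiK psiK]]]] := exists_coordinates rho_simple.1.
have [i0 [i1 i01]] : exists i0 i1, ~~ connect (root_rel regular_pred) i0 i1.
  apply: contrapT => no; apply: nconn => i j; apply: contrapT => /negP ij.
  by apply: no; exists i, j.
have [||||e [ee e0 e1 eS]] := separated_has_idempotent char0F regular_pred_linear S_tr
  regular_pred_torus splitF (rep_mx_br phiK rho_rep)
  (P := connect (root_rel regular_pred) i0) (i0 := i0) (i1 := i1).
- exact: connect0.
- exact: i01.
- move=> i j ij; rewrite -!topredE /=; apply/idP/idP => h; apply: (connect_trans h); apply: connect1 => //.
  by rewrite root_rel_sym.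
- have [X tX xE] := sl_of_surj x; exists X => //.
  apply: contraNneq xv => /eqP; rewrite /rep_mx oppr_eq0 => /eqP rX0.
  by rewrite -xE (mx_of_end_inj phiK (etrans rX0 (esym (linear0 _)))) lfunE.
apply: (decomposable_of_idempotent phiK psiK ee e0 e1).
exact/commutes_rep_mx.
Qed.

End RegularSubalgebras.

Theorem regular_sl_narrow_or_wide (F : fieldType) (n : nat) (s : {vspace sl F n.+1}) :
  splits_polys F -> [pchar F] =i pred0 -> regular s -> narrow s \/ wide s.
Proof.
move=> splitF char0F [_ [H cartanH H_norm]].
have [P Punit torusH] := cartan_contains_torus splitF char0F cartanH.
exact: (torus_normalized_narrow_or_wide splitF char0F Punit torusH H_norm).
Qed.

Theorem theorem4p3 (R : realType) (n : nat) (hn : (1 <= n)%N)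
  (s : {vspace sl R[i] n.+1}) (hs : regular s) : narrow s \/ wide s.
Proof.
apply: regular_sl_narrow_or_wide hs; last exact: pchar_num.
by move=> p; have [l pE] := closed_field_poly_normal p; exists l.
Qed.
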